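(* Let $G$ be a simply connected semisimple linear algebraic group over $\mathbb C$ and let $G^\vee$ be the simply connected semisimple group whose Lie algebra is Langlands dual to that of $G$. Let $\mathbb T$, $\mathbb T^\vee$ be their maximal tori, $W$ their common Weyl group, and $\tau_0\in W$ the longest element. Then for all $\omega,\sigma\in W$ the normalized local elliptic classes $\mathbb E$ satisfy $$(-1)^{\ell(\tau_0)}\,\Big(\mathbb E_{\tau_0\omega^{-1}}(X_{\tau_0\sigma^{-1}})\Big)^{\#}=\mathbb E_{\sigma}(X^\vee_\omega),$$ where $\mathbb E_\bullet(X_\bullet)$ denotes the classes of $G/B$, $\mathbb E_\bullet(X^\vee_\bullet)$ denotes the classes of $G^\vee/B^\vee$, and $\#$ denotes precomposition with the map $$\mathbb T^\vee\times\mathbb T\times\mathbb C^*\to\mathbb T\times\mathbb T^\vee\times\mathbb C^*,\qquad (a,b,c)\mapsto(\tau_0(b)^{-1},a,c^{-1}),$$ that is, the substitution $$\zeta_s:=\tau_0(\bar\nu_s),\qquad \nu_s:=\bar\zeta_s^{-1},\qquad h:=h^{-1}.$$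
   Context: Theta functions. Fix $q\in\mathbb C^*$ with $|q|<1$ and put $$\vartheta(x)=x^{1/2}(1-x^{-1})\prod_{n\ge1}(1-q^nx)(1-q^n/x),\qquad \delta(a,b)=\frac{\vartheta(ab)\,\vartheta'(1)}{\vartheta(a)\,\vartheta(b)}$$ (the half-integer powers cancel in $\delta$, so $\delta$ is a single-valued meromorphic function). Lie theory. $\mathbb T\subset B\subset G$ are a maximal torus and a Borel subgroup, $\mathfrak t=\mathrm{Lie}(\mathbb T)$, $W=N(\mathbb T)/\mathbb T$ is the Weyl group with length function $\ell$ and longest element $\tau_0$. $\Phi_+\subset\mathfrak t^*$ is the set of positive roots, $\Pi\subset W$ the set of all reflections, $S\subset\Pi$ the set of simple reflections. For $s\in\Pi$, $\alpha_s\in\Phi_+$ is the corresponding positive root and $\alpha_s^\vee\in\mathfrak t$ its coroot. The group $G^\vee$ has maximal torus $\mathbb T^\vee$ with $\mathrm{Lie}(\mathbb T^\vee)=\mathfrak t^*$, positive roots $\alpha_s^\vee$ ($s\in\Pi$), coroots $\alpha_s$, and the same Weyl group $W$ with the same reflections and simple reflections; $B^\vee$ is its Borel subgroup. Variables for $G$. For $s\in\Pi$ put $\zeta_s=e^{-\alpha_s}:\mathbb T\to\mathbb C^*$ (equivariant variables) and $\nu_s=h^{\alpha_s^\vee}:\mathbb T^\vee\to\mathbb C^*$ (dynamical variables). Here $h^{\lambda}$, for $\lambda$ in the coroot lattice, is formal exponential notation for the character of $\mathbb T^\vee$ attached to $\lambda$ (so $h^{\lambda}h^{\mu}=h^{\lambda+\mu}$),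 and these characters are independent of the separate variable $h\in\mathbb C^*$. All classes below are meromorphic functions on $\mathbb T\times\mathbb T^\vee\times\mathbb C^*$ in the variables $\zeta$, $\nu$, $h$. For $w\in W$: $w(e^{\lambda})=e^{w\lambda}$ and $w(h^{\lambda})=h^{w\lambda}$; in particular $\sigma(\zeta_s)=e^{-\sigma(\alpha_s)}$. For $s\in S$, $s^\nu$ is the operator on functions induced by $h^\lambda\mapsto h^{s\lambda}$, leaving the equivariant variables and $h$ unchanged. Local elliptic classes. For $\omega\in W$, $X_\omega\subset G/B$ is the Schubert variety, the closure of the $B$-orbit of the $\mathbb T$-fixed point corresponding to $\omega$. The local elliptic class $E_\sigma(X_\omega)$ ($\omega,\sigma\in W$) is the restriction of the $\mathbb T$-equivariant elliptic class $E(X_\omega)$ to the fixed point $\sigma$, divided by the Euler class of $T_\sigma(G/B)$. For the present purpose it may be taken as defined by the following: $E_{\mathrm{id}}(X_{\mathrm{id}})=1$, $E_\sigma(X_{\mathrm{id}})=0$ for $\sigma\ne\mathrm{id}$, and, for all $s\in S$ and $\omega,\sigma\in W$, $$\delta(\sigma(\zeta_s),\nu_s)\,s^\nu E_\sigma(X_\omega)+\delta(\sigma(\zeta_s),h)\,s^\nu E_{\sigma s}(X_\omega)=\begin{cases}E_\sigma(X_{\omega s})&\text{if }\ell(\omega s)=\ell(\omega)+1,\\ \delta(\nu_s,h)\,\delta(\nu_s^{-1},h)\,E_\sigma(X_{\omega s})&\text{if }\ell(\omega s)=\ell(\omega)-1\end{cases}$$ (Bott–Samelson recursion). It is a known theorem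 (Rimányi–Weber) that such a family exists (it is clearly unique), and that it also satisfies the R-matrix recursion: for all $s\in S$, $\omega,\sigma\in W$, $$\delta(\zeta_s,\omega^{-1}(\nu_s))\,E_\sigma(X_\omega)+s^\zeta\big(\delta(\zeta_s,h)\,E_{s\sigma}(X_\omega)\big)=\begin{cases}E_\sigma(X_{s\omega})&\text{if }\ell(s\omega)=\ell(\omega)+1,\\ \delta(\omega^{-1}(\nu_s),h)\,\delta(\omega^{-1}(\nu_s^{-1}),h)\,E_\sigma(X_{s\omega})&\text{if }\ell(s\omega)=\ell(\omega)-1,\end{cases}$$ where $s^\zeta$ is the operator induced by $e^\lambda\mapsto e^{s\lambda}$, leaving the dynamical variables and $h$ unchanged. Normalization. For $\omega\in W$ let $$c(G,\omega)=\prod_{s\in\Pi:\ \omega(\alpha_s)\in\Phi_+}\delta(\nu_s^{-1},h),\qquad \mathbb E_\sigma(X_\omega)=c(G,\omega)\cdot E_\sigma(X_\omega).$$ Dual side. $\mathbb E_\sigma(X^\vee_\omega)$ denotes the function obtained by the same construction for the group $G^\vee$ and the Schubert variety $X^\vee_\omega\subset G^\vee/B^\vee$, with the equivariant variables $\zeta_s$ replaced by $\bar\zeta_s=\nu_s^{-1}=e^{-\alpha_s^\vee}:\mathbb T^\vee\to\mathbb C^*$ and the dynamical variables $\nu_s$ replaced by $\bar\nu_s=\zeta_s^{-1}:\mathbb T\to\mathbb C^*$ (the character attached to $\alpha_s$, the coroot of $G^\vee$). It is a meromorphic function on $\mathbb T^\vee\times\mathbb T\times\mathbb C^*$. For $w\in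 W$, $w(\bar\nu_s)$ is the character of $\mathbb T$ attached to $w(\alpha_s)$; in particular $\tau_0(\bar\nu_s)=\bar\nu_{\tau_0s\tau_0}^{-1}$. *)

(* Defs.v *)
From HB Require Import structures.
From mathcomp Require Import all_boot all_order all_algebra all_fingroup.
From mathcomp Require Import complex.
From mathcomp Require Import all_classical all_reals all_analysis.
Set Implicit Arguments.
Unset Strict Implicit.
Unset Printing Implicit Defensive.
Import Order.TTheory GRing.Theory Num.Theory.
Import numFieldNormedType.Exports.
Local Open Scope classical_set_scope.
Local Open Scope ring_scope.
Local Open Scope complex_scope.

(* R[i] packed as a numClosedFieldType: the topology, norm and differential
   calculus of MathComp-Analysis are inferred from the packed structure. *)
Definition Cx (R : realType) : numClosedFieldType := R[i].

(** * Root systems *)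

(* A reduced crystallographic root system of rank r with a chosen base; this
   is the combinatorial datum (up to isomorphism) of a simply connected
   semisimple complex group with its maximal torus and Borel subgroup.
   The roots are the elements of rs_root. Roots are given by their integer
   coordinates (rs_vec) in the basis of simple roots, coroots by their integer
   coordinates (rs_covec) in the basis of simple coroots, and
   rs_cartan i j = <alpha_i, alpha_j^vee>.
   The axioms are symmetric in roots and coroots, as in the definition of a
   root datum, so that the dual system is obtained by exchanging both; for
   every root system, the statements about coroots follow from those about
   roots. *)
Record rootSystem (r : nat) := RootSystem {
  rs_root : finType;
  rs_cartan : 'M[int]_r;
  rs_vec : rs_root -> 'rV[int]_r;
  rs_covec : rs_root -> 'rV[int]_r;
  rs_simple : 'I_r -> rs_root;
  rs_refl : rs_root -> {perm rs_root};
  rs_vec_inj : injective rs_vec;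
  rs_covec_inj : injective rs_covec;
  rs_vec_simple : forall i, rs_vec (rs_simple i) = delta_mx 0 i;
  rs_covec_simple : forall i, rs_covec (rs_simple i) = delta_mx 0 i;
  rs_pair2 : forall a, (rs_vec a *m rs_cartan *m (rs_covec a)^T) 0 0 = 2;
  rs_vec_refl : forall a b, rs_vec (rs_refl a b) =
    rs_vec b - (rs_vec b *m rs_cartan *m (rs_covec a)^T) 0 0 *: rs_vec a;
  rs_covec_refl : forall a b, rs_covec (rs_refl a b) =
    rs_covec b - (rs_vec a *m rs_cartan *m (rs_covec b)^T) 0 0 *: rs_covec a;
  rs_vec_reduced : forall a b (m n : int), m != 0 ->
    m *: rs_vec a = n *: rs_vec b -> b = a \/ b = rs_refl a a;
  rs_covec_reduced : forall a b (m n : int), m != 0 ->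
    m *: rs_covec a = n *: rs_covec b -> b = a \/ b = rs_refl a a;
  rs_sign : forall a,
    (forall i, 0 <= rs_vec a 0 i /\ 0 <= rs_covec a 0 i) \/
    (forall i, rs_vec a 0 i <= 0 /\ rs_covec a 0 i <= 0) }.

Section Dual.
Variables (r : nat) (Phi : rootSystem r).

Lemma dual_pairE (x y : 'rV[int]_r) :
  (x *m (rs_cartan Phi)^T *m y^T) 0 0 = (y *m rs_cartan Phi *m x^T) 0 0.
Proof.
have -> : x *m (rs_cartan Phi)^T *m y^T = (y *m rs_cartan Phi *m x^T)^T.
  by rewrite !trmx_mul trmxK mulmxA.
by rewrite mxE.
Qed.

Lemma dual_pair2 (a : rs_root Phi) :
  (rs_covec a *m (rs_cartan Phi)^T *m (rs_vec a)^T) 0 0 = 2.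
Proof. by rewrite dual_pairE rs_pair2. Qed.

Lemma dual_vec_refl (a b : rs_root Phi) : rs_covec (rs_refl a b) =
  rs_covec b - (rs_covec b *m (rs_cartan Phi)^T *m (rs_vec a)^T) 0 0
               *: rs_covec a.
Proof. by rewrite dual_pairE rs_covec_refl. Qed.

Lemma dual_covec_refl (a b : rs_root Phi) : rs_vec (rs_refl a b) =
  rs_vec b - (rs_covec a *m (rs_cartan Phi)^T *m (rs_vec b)^T) 0 0
             *: rs_vec a.
Proof. by rewrite dual_pairE rs_vec_refl. Qed.

Lemma dual_sign (a : rs_root Phi) :
  (forall i, 0 <= rs_covec a 0 i /\ 0 <= rs_vec a 0 i) \/
  (forall i, rs_covec a 0 i <= 0 /\ rs_vec a 0 i <= 0).
Proof.
by have [ap|an] := rs_sign a; [left=> i; have [] := ap i|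
  right=> i; have [] := an i].
Qed.

(* The root system of G^vee: same index set, same reflections and same simple
   indices, the root of index a being the coroot of index a of Phi. *)
Definition dual : rootSystem r :=
  @RootSystem r (rs_root Phi) (rs_cartan Phi)^T (@rs_covec r Phi)
    (@rs_vec r Phi) (@rs_simple r Phi) (@rs_refl r Phi)
    (@rs_covec_inj r Phi) (@rs_vec_inj r Phi)
    (@rs_covec_simple r Phi) (@rs_vec_simple r Phi) dual_pair2
    dual_vec_refl dual_covec_refl
    (@rs_covec_reduced r Phi) (@rs_vec_reduced r Phi) dual_sign.

End Dual.

Section Weyl.
Variables (r : nat) (Phi : rootSystem r).

Definition positive (a : rs_root Phi) : bool := [forall i, 0 <= rs_vec a 0 i].

(* W acts faithfully on the roots; it is realised as a group of permutations
   of the index set. *)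
Definition weyl : {group {perm rs_root Phi}} :=
  <<[set rs_refl a | a : rs_root Phi]%SET>>%G.

(* The product u v of W is the composition u \o v, whereas the product
   of {perm _} applies its left factor first. *)
Definition wmul (u v : {perm rs_root Phi}) : {perm rs_root Phi} := (v * u)%g.

Definition wsimple (i : 'I_r) : {perm rs_root Phi} := rs_refl (rs_simple Phi i).

Definition is_word_length (w : {perm rs_root Phi}) (n : nat) : bool :=
  [exists t : n.-tuple 'I_r, w == (\prod_(i <- t) wsimple i)%g].

Definition wlen (w : {perm rs_root Phi}) : nat :=
  match pselect (exists n, is_word_length w n) with
  | left ex => ex_minn ex
  | right _ => 0
  end.

Definition longest (w : {perm rs_root Phi}) : Prop :=
  w \in weyl /\ forall v, v \in weyl -> (wlen v <= wlen w)%N.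

End Weyl.

Section Analysis.
Variable R : realType.
Notation C := (Cx R).

(** * Theta functions *)

(* theta_br q y x is vartheta(x), where y stands for x^(1/2). *)
Definition theta_br (q y x : C) : C :=
  y * (1 - x^-1) *
  lim ((\prod_(1 <= n < N.+1) ((1 - q ^+ n * x) * (1 - q ^+ n / x)))
         @[N --> \oo]).

(* vartheta on the principal branch of the square root *)
Definition theta (q x : C) : C := theta_br q (sqrtc x) x.

(* (ab)^(1/2) is taken to be the product of the square roots of a and b used in
   the denominator, so that delta does not depend on the choice of branches. *)
Definition delta (q a b : C) : C :=
  theta_br q (sqrtc a * sqrtc b) (a * b) * derive1 (theta q) 1 /
  (theta q a * theta q b).

(** * Tori *)

Section Torus.
Variables (r : nat) (Phi : rootSystem r).

(* The maximal torus of the simply connected group is the coroot lattice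
   tensored with C^*: t stands for the product of the alpha_i^vee(t_i), i.e.
   the t_i are the values at t of the fundamental weights. *)
Definition torus : set 'rV[C]_r := [set t | forall i, t 0 i != 0].

(* e^x, for x in the root lattice given in the basis of simple roots *)
Definition expc (x : 'rV[int]_r) (t : 'rV[C]_r) : C :=
  \prod_i exprz (t 0 i) ((x *m rs_cartan Phi) 0 i).

(* w (\prod_i alpha_i^vee(t_i)) = \prod_i (w alpha_i^vee)(t_i), so that
   e^x (w t) = e^(w^-1 x) (t) *)
Definition tact (w : {perm rs_root Phi}) (t : 'rV[C]_r) : 'rV[C]_r :=
  \row_j \prod_i exprz (t 0 i) (rs_covec (w (rs_simple Phi i)) 0 j).

Definition tinv (t : 'rV[C]_r) : 'rV[C]_r := \row_j (t 0 j)^-1.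

End Torus.

(** * Meromorphic functions on T x T^vee x C^* *)

Definition domain (r : nat) : set ('rV[C]_r * 'rV[C]_r * C) :=
  [set p | [/\ torus p.1.1, torus p.1.2 & p.2 != 0]].

(* A meromorphic function is represented by a total function which is locally
   the quotient of two holomorphic functions g / d with d not identically 0;
   its values at the zeros of d are irrelevant. *)
Definition meromorphic (r : nat) (f : 'rV[C]_r * 'rV[C]_r * C -> C) : Prop :=
  forall p, @domain r p ->
  exists g d : 'rV[C]_r * 'rV[C]_r * C -> C,
    [/\ \forall x \near p, differentiable g x /\ differentiable d x,
        ~ (\forall x \near p, d x = 0) &
        \forall x \near p, d x != 0 -> f x = g x / d x].

(* Equality of meromorphic functions: equality on a dense open subset. *)
Definition eqmero (r : nat) (f g : 'rV[C]_r * 'rV[C]_r * C -> C) : Prop :=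
  @domain r `<=` closure (interior [set p | f p = g p]).

(** * Local elliptic classes *)

Section Elliptic.
Variables (q : C) (r : nat) (Phi : rootSystem r).
Notation W := {perm rs_root Phi}.
Notation fct := ('rV[C]_r * 'rV[C]_r * C -> C).

(* In the sequel a point is (t, u, h) with t in T and u in T^vee. A reflection
   is represented by its positive root, and zeta and nu are defined for
   all roots, so that w(zeta_s) is zeta (w alpha_s). *)
Definition zeta (a : rs_root Phi) (p : 'rV[C]_r * 'rV[C]_r * C) : C :=
  expc Phi (- rs_vec a) p.1.1.

Definition nu (a : rs_root Phi) (p : 'rV[C]_r * 'rV[C]_r * C) : C :=
  expc (dual Phi) (rs_covec a) p.1.2.

(* the operator on functions induced by h^lambda |-> h^(w lambda) *)
Definition dynact (w : W) (f : fct) : fct := fun p =>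
  f (p.1.1, @tact r (dual Phi) w^-1%g p.1.2, p.2).

(* E w v is E_v(X_w): the first argument is the Schubert variety, the second
   one the fixed point. *)
Definition is_local_elliptic_class (E : W -> W -> fct) : Prop :=
  [/\ forall w v, w \in weyl Phi -> v \in weyl Phi -> meromorphic (E w v),
      eqmero (E 1%g 1%g) (fun=> 1),
      forall v, v \in weyl Phi -> v != 1%g -> eqmero (E 1%g v) (fun=> 0) &
      forall (i : 'I_r) w v, w \in weyl Phi -> v \in weyl Phi ->
        let a := rs_simple Phi i in
        let s := wsimple Phi i in
        let lhs : fct := fun p =>
          delta q (zeta (v a) p) (nu a p) * dynact s (E w v) p +
          delta q (zeta (v a) p) p.2 * dynact s (E w (wmul v s)) p in
        (wlen (wmul w s) = (wlen w).+1 -> eqmero lhs (E (wmul w s) v)) /\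
        (wlen w = (wlen (wmul w s)).+1 ->
           eqmero lhs (fun p => delta q (nu a p) p.2 *
             delta q (nu a p)^-1 p.2 * E (wmul w s) v p))].

Definition cnorm (w : W) : fct := fun p =>
  \prod_(a | positive a && positive (w a)) delta q (nu a p)^-1 p.2.

Definition normalized (E : W -> W -> fct) (w v : W) : fct := fun p =>
  cnorm w p * E w v p.

(* The operation #: p = (a, b, c) is a point of T^vee x T x C^*. *)
Definition sharp (w0 : W) (f : fct) : fct := fun p =>
  f (tinv (@tact r Phi w0 p.1.2), p.1.1, p.2^-1).

End Elliptic.

End Analysis.

(* Main.v *)
Require Import Defs.
From mathcomp Require Import all_boot all_order all_algebra all_fingroup.
From mathcomp Require Import complex ring lra zify.
From mathcomp Require Import all_classical all_reals all_analysis.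
Set Implicit Arguments.
Unset Strict Implicit.
Unset Printing Implicit Defensive.
Import Order.TTheory GRing.Theory Num.Theory.
Import numFieldNormedType.Exports.
Local Open Scope ring_scope.

(** The duality exchanges Schubert varieties with fixed points, by
    (w, v) |-> (tau0 v^-1, tau0 w^-1), and equivariant with dynamical variables.
    Because of the inverses, multiplications on the right become multiplications
    on the left, so that the Bott-Samelson recursion of the dual group has to
    come from a recursion of the classes of G by multiplication on the left.
    This is the R-matrix recursion.

    The R-matrix recursion follows from the Bott-Samelson recursion ([rmatrix]).
    Both express one class in terms of two others by an operator; one acts on
    the left and on the equivariant variables, the other on the right and on the
    dynamical variables, so that they commute. The R-matrix recursion therefore
    spreads from w = 1 to all of W along words in the simple reflections. This
    uses neither a division nor an identity between theta functions.

    Written in the variables of the dual group and solved for another of its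
    three terms, the R-matrix recursion becomes the Bott-Samelson recursion of
    the dual group up to the factors delta(nu, h) delta(1/nu, h) and signs. The
    normalizations absorb these ([sharp_recursion], [cnorm_dynpt]), thanks to
    delta(1/a, 1/b) = - delta(a, b) ([delta_inv]) and because multiplication by
    a simple reflection changes the set of inversions by one root. The initial
    conditions agree too ([sharp_class_id]): the class of X_w vanishes at the
    fixed point tau0 unless w = tau0 ([elliptic_support]), and its value there
    is a product over the positive roots ([elliptic_diagonal]). An induction on
    w concludes ([sharp_class_dual]).

    The last step cancels a factor delta(nu_s, h), which has to be nonzero on a
    dense open set ([generic_delta_neq0]). This rests on the convergence of the
    product defining theta to a function which vanishes at the powers of q only,
    and on theta'(1) being different from 0 ([theta_derive1],
    [theta_prod1_neq0]). Equalities of meromorphic functions are handled through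
    the filter of sets with dense interior in the domain ([generic]), which the
    changes of variables preserve.

    On the side of the Weyl group, the length is the number of positive roots
    made negative ([wlen_ninv]), by the exchange condition. *)

(** * Roots and reflections *)

Section RootSystem.
Variables (r : nat) (Phi : rootSystem r).
Implicit Types (a b c : rs_root Phi) (i j : 'I_r) (w : {perm rs_root Phi}).

Definition pairing a b : int :=
  (rs_vec a *m rs_cartan Phi *m (rs_covec b)^T) 0 0.

(** The root of index [opp a] is the negative of the root of index [a]. *)
Definition opp a : rs_root Phi := rs_refl a a.

Lemma pairing_refl c a b : pairing (rs_refl c a) (rs_refl c b) = pairing a b.
Proof.
rewrite /pairing rs_vec_refl rs_covec_refl.
rewrite [(_ - _)^T]linearB /= [(_ *: _)^T]linearZ /= !(mulmxBl, mulmxBr).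
rewrite -!(scalemxAl, scalemxAr) /=.
have P2 := rs_pair2 c.
rewrite !mxE in P2 *; rewrite P2; ring.
Qed.

Lemma vec_opp a : rs_vec (opp a) = - rs_vec a.
Proof.
rewrite /opp rs_vec_refl rs_pair2 scaler_nat mulr2n opprD addrA subrr sub0r.
by [].
Qed.

Lemma vec_neq0 a : rs_vec a != 0.
Proof.
by apply/eqP => a0; have := rs_pair2 a; rewrite a0 !mul0mx mxE.
Qed.

Lemma positiveP a : reflect (forall i, 0 <= rs_vec a 0 i) (positive a).
Proof. exact: forallP. Qed.

Lemma negativeP a : reflect (forall i, rs_vec a 0 i <= 0) (~~ positive a).
Proof.
apply: (iffP idP) => [|neg].
  by case: (rs_sign a) => ha; last (by move=> _ i; case: (ha i));
    move/positiveP; case=> i; case: (ha i).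
apply/positiveP => pos; have /eqP[] := vec_neq0 a.
by apply/rowP => i; apply/le_anti; rewrite mxE neg pos.
Qed.

Lemma positive_opp a : positive (opp a) = ~~ positive a.
Proof.
by apply/positiveP/negativeP => h i; have := h i; rewrite vec_opp mxE oppr_ge0.
Qed.

Lemma oppK : involutive opp.
Proof. by move=> a; apply: (@rs_vec_inj r Phi); rewrite !vec_opp opprK. Qed.

Lemma reflK a b : rs_refl a (rs_refl a b) = b.
Proof.
have: rs_vec (rs_refl a (rs_refl a b)) = rs_vec b; last exact: rs_vec_inj.
rewrite !rs_vec_refl; apply/rowP => i; have P2 := rs_pair2 a.
rewrite !(mulmxBl) -!scalemxAl.
rewrite !mxE in P2 *; rewrite P2; ring.
Qed.

Lemma refl_involutive a : (rs_refl a * rs_refl a)%g = 1%g.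
Proof. by apply/permP => b; rewrite permM perm1 reflK. Qed.

Lemma refl_weyl a : rs_refl a \in weyl Phi.
Proof. by apply/mem_gen/imsetP; exists a. Qed.

Lemma weyl_closed (P : {perm rs_root Phi} -> Prop) :
    P 1%g -> (forall u v, P u -> P v -> P (u * v)%g) ->
    (forall a, P (rs_refl a)) -> forall w, w \in weyl Phi -> P w.
Proof.
move=> P1 PM Pr w /gen_prodgP[n [c cA ->]].
by apply: big_ind => // k _; have /imsetP[a _ ->] := cA k.
Qed.

Lemma pairing_weyl w a b : w \in weyl Phi -> pairing (w a) (w b) = pairing a b.
Proof.
move=> ww; move: w ww a b; apply: weyl_closed => [a b|u v hu hv a b|c a b].
- by rewrite !perm1.
- by rewrite !permM hv hu.
- exact: pairing_refl.
Qed.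

(** The permutations of the roots in W come from linear maps, so that they are
    determined by their values on the simple roots. *)
Lemma weyl_linear w : w \in weyl Phi ->
  exists M, forall a, rs_vec (w a) = rs_vec a *m M.
Proof.
move: w; apply: weyl_closed => [|u v [M hM] [N hN]|c].
- by exists 1%:M => a; rewrite perm1 mulmx1.
- by exists (M *m N) => a; rewrite permM hN hM mulmxA.
exists (1%:M - rs_cartan Phi *m (rs_covec c)^T *m rs_vec c) => a.
rewrite rs_vec_refl mulmxBr mulmx1 !mulmxA [X in X *m rs_vec c]mx11_scalar.
by rewrite mul_scalar_mx.
Qed.

Lemma vec_weyl w a : w \in weyl Phi ->
  rs_vec (w a) = \sum_i rs_vec a 0 i *: rs_vec (w (rs_simple Phi i)).
Proof.
move=> /weyl_linear[M hM]; rewrite hM [in LHS](row_sum_delta (rs_vec a)).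
rewrite mulmx_suml; apply: eq_bigr => i _.
by rewrite hM rs_vec_simple -scalemxAl.
Qed.

Lemma weyl_opp w a : w \in weyl Phi -> w (opp a) = opp (w a).
Proof.
move=> /weyl_linear[M hM]; apply: (@rs_vec_inj r Phi).
by rewrite vec_opp !hM vec_opp mulNmx.
Qed.

(** The reflection in a root is defined from the pairing with its coroot, which
    W preserves; hence roots and reflections correspond equivariantly. *)
Lemma refl_conj w a : w \in weyl Phi -> (rs_refl a ^ w)%g = rs_refl (w a).
Proof.
move=> ww; apply/permP => b; rewrite conjgE !permM.
apply: (@rs_vec_inj r Phi); rewrite rs_vec_refl.
have [M hM] := weyl_linear ww; rewrite hM rs_vec_refl mulmxBl -hM permKV.
rewrite -scalemxAl -hM; congr (_ - _ *: _).
by rewrite -[LHS]/(pairing _ _) -(pairing_weyl _ _ ww) permKV.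
Qed.

Lemma refl_opp a : rs_refl (opp a) = rs_refl a.
Proof. by rewrite -(refl_conj _ (refl_weyl a)) conjgE mulKg. Qed.

Lemma positive_simple i : positive (rs_simple Phi i).
Proof.
by apply/positiveP => j; rewrite rs_vec_simple mxE; case: eqP.
Qed.

(** Subtracting a multiple of a simple root alters one coordinate only, and a
    root with a positive coordinate left over is positive. *)
Lemma positive_wsimple i b : positive b -> b != rs_simple Phi i ->
  positive (wsimple Phi i b).
Proof.
move=> bp; apply: contraR => /negativeP sbn.
have b0 j : j != i -> rs_vec b 0 j = 0.
  move=> ji; have := sbn j; have := positiveP _ bp j.
  rewrite /wsimple rs_vec_refl rs_vec_simple !mxE (negbTE ji) andbF mulr0 subr0.
  by move=> h1 h2; apply/le_anti; rewrite h1 h2.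
have : 1 *: rs_vec b = rs_vec b 0 i *: rs_vec (rs_simple Phi i).
  rewrite scale1r rs_vec_simple; apply/rowP => j; rewrite !mxE /=.
  by case: eqP => [->|/eqP/b0->]; rewrite ?mulr1 ?mulr0.
move=> /(rs_vec_reduced (oner_neq0 _))[->//|bo].
by have := positive_simple i; rewrite bo -/(opp b) positive_opp bp.
Qed.

Definition inversions w : {set rs_root Phi} :=
  [set a | positive a & ~~ positive (w a)].

Definition ninv w : nat := #|inversions w|.

Lemma inversions1 : inversions 1%g = finset.set0.
Proof. by apply/finset.setP => a; rewrite !inE perm1 andbN. Qed.

(** Since s_i permutes the positive roots other than alpha_i, composing with it
    on the right transports the inversions of w and adds alpha_i. *)
Lemma inversions_wmul w i : w \in weyl Phi -> positive (w (rs_simple Phi i)) ->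
  inversions (wmul w (wsimple Phi i)) =
    rs_simple Phi i |: (wsimple Phi i @: inversions w)%SET.
Proof.
move=> ww wp; apply/finset.setP => a; rewrite !inE permM.
have [->|ai] /= := eqVneq a (rs_simple Phi i).
  by rewrite positive_simple weyl_opp // positive_opp wp.
rewrite -[X in X \in _](reflK (rs_simple Phi i)) (mem_imset _ _ perm_inj).
have sK := reflK (rs_simple Phi i).
rewrite inE; apply/andP/andP => -[ap wn]; split=> //.
  exact: positive_wsimple.
rewrite -(sK a); apply: positive_wsimple => //.
by apply: contraNneq wn => /= ->.
Qed.

End RootSystem.

(** * Words, inversions and length *)

Section Length.
Variables (r : nat) (Phi : rootSystem r).
Implicit Types (a b c : rs_root Phi) (i j : 'I_r) (w : {perm rs_root Phi}).
Local Notation alpha := (rs_simple Phi).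
Local Notation s_ := (wsimple Phi).

Lemma wmul_weyl u v : u \in weyl Phi -> v \in weyl Phi ->
  wmul u v \in weyl Phi.
Proof. by move=> uW vW; exact: groupM. Qed.

Lemma wsimple_weyl i : s_ i \in weyl Phi.
Proof. exact: refl_weyl. Qed.

Lemma wmul_wsimpleK w i : wmul (wmul w (s_ i)) (s_ i) = w.
Proof. by rewrite /wmul mulgA refl_involutive mul1g. Qed.

Lemma wsimple_alpha i : s_ i (alpha i) = opp (alpha i).
Proof. by []. Qed.

Lemma positive_wmul w i : w \in weyl Phi ->
  positive (wmul w (s_ i) (alpha i)) = ~~ positive (w (alpha i)).
Proof. by move=> ww; rewrite permM wsimple_alpha weyl_opp // positive_opp. Qed.

Lemma ninv_wmul w i : w \in weyl Phi -> positive (w (alpha i)) ->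
  ninv (wmul w (s_ i)) = (ninv w).+1.
Proof.
move=> ww wp; rewrite /ninv inversions_wmul // cardsU1.
rewrite card_imset; last exact: perm_inj.
rewrite (_ : _ \notin _) //; apply/imsetP => -[b]; rewrite inE => /andP[bp _] e.
have eb : b = opp (alpha i) by rewrite -wsimple_alpha e reflK.
by move: bp; rewrite eb positive_opp positive_simple.
Qed.

Lemma ninv_wmul_neg w i : w \in weyl Phi -> ~~ positive (w (alpha i)) ->
  ninv w = (ninv (wmul w (s_ i))).+1.
Proof.
move=> ww wn; rewrite -[in LHS](wmul_wsimpleK w i) ninv_wmul //.
  by rewrite wmul_weyl // wsimple_weyl.
by rewrite positive_wmul.
Qed.

(** The letters are composed from right to left: the first letter of the
    sequence is applied first. *)
Definition word (t : seq 'I_r) : {perm rs_root Phi} := (\prod_(i <- t) s_ i)%g.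

Lemma word_cons i t : word (i :: t) = wmul (word t) (s_ i).
Proof. by rewrite /word big_cons. Qed.

Lemma word_rcons i t : word (rcons t i) = wmul (s_ i) (word t).
Proof. by rewrite /word big_rcons. Qed.

Lemma word_cat t u : word (t ++ u) = (word t * word u)%g.
Proof. by rewrite /word big_cat. Qed.

Lemma word_weyl t : word t \in weyl Phi.
Proof.
elim: t => [|i t IH]; first by rewrite /word big_nil group1.
by rewrite word_cons wmul_weyl // wsimple_weyl.
Qed.

Lemma covec_sum_simple a :
  rs_covec a = \sum_i rs_covec a 0 i *: rs_covec (alpha i).
Proof.
by rewrite [LHS]row_sum_delta; apply: eq_bigr => i _; rewrite rs_covec_simple.
Qed.

Lemma covec_ge0 a i : positive a -> 0 <= rs_covec a 0 i.
Proof.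
move=> ap; case: (rs_sign a) => [/(_ i)[]//|an].
have : ~~ positive a by apply/negativeP => j; case: (an j).
by rewrite ap.
Qed.

Lemma pairing_sumr a b :
  pairing a b = \sum_i rs_covec b 0 i * pairing a (alpha i).
Proof.
rewrite {1}/pairing [in LHS]covec_sum_simple [(\sum_i _)^T]linear_sum /=.
rewrite mulmx_sumr summxE.
by apply: eq_bigr => i _; rewrite [(_ *: _)^T]linearZ /= -scalemxAr mxE.
Qed.

(** Otherwise the root would pair nonpositively with its own coroot, which is a
    nonnegative combination of simple coroots, whereas that pairing is 2. *)
Lemma exists_pairing_gt0 a : positive a -> exists i, 0 < pairing a (alpha i).
Proof.
move=> ap; have [/existsP//|] := boolP [exists i, 0 < pairing a (alpha i)].
rewrite negb_exists => /forallP h; exfalso.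
have : pairing a a <= 0.
  rewrite pairing_sumr; apply: sumr_le0 => i _.
  by rewrite mulr_ge0_le0 // ?covec_ge0 // leNgt.
by rewrite /pairing rs_pair2.
Qed.

Definition height a : int := \sum_i rs_vec a 0 i.

(** Reflecting a positive root which is not simple in a simple root with which
    it pairs positively lowers its height and conjugates its reflection. *)
Lemma refl_word a : exists t, rs_refl a = word t.
Proof.
wlog ap : a / positive a.
  have [ap|an] := boolP (positive a); first exact.
  by rewrite -[a]oppK refl_opp; apply; rewrite positive_opp.
have [n] := ubnP `|height a|%N; elim: n a ap => // n IH a ap hn.
have [i hi] := exists_pairing_gt0 ap.
have [->|ai] := eqVneq a (alpha i).
  by exists [:: i]; rewrite /word big_seq1.
have sp := positive_wsimple ap ai.
have height_ge0 b : positive b -> 0 <= height b.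
  by move=> /positiveP bp; apply: sumr_ge0 => k _.
have hs : height (s_ i a) = height a - pairing a (alpha i).
  rewrite /height rs_vec_refl -/(pairing _ _) rs_vec_simple.
  under eq_bigr do rewrite !mxE /=.
  rewrite sumrB; congr (_ - _); rewrite -mulr_sumr.
  by rewrite (bigD1 i) //= eqxx big1 ?addr0 ?mulr1 // => k /negbTE ->.
case: (IH _ sp).
  have := height_ge0 _ sp; have := height_ge0 _ ap; rewrite hs; lia.
move=> t ht; exists (i :: rcons t i).
rewrite word_cons word_rcons /wmul -ht.
rewrite -(refl_conj _ (wsimple_weyl i)) conjgE.
by rewrite -[in RHS]mulgA mulKVg -mulgA refl_involutive mulg1.
Qed.

Lemma weyl_word w : w \in weyl Phi -> exists t, w = word t.
Proof.
move: w; apply: weyl_closed; [by exists [::]; rewrite /word big_nil| |].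
  by move=> _ _ [t ->] [u ->]; exists (t ++ u); rewrite word_cat.
exact: refl_word.
Qed.

(** The exchange condition. Following the simple root through the word, there
    is a letter at which it turns negative; before that letter it is the
    simple root of the letter, so that the two reflections are conjugate and
    the letter cancels. *)
Lemma exchange t i : ~~ positive (word t (alpha i)) ->
  exists2 u, (size u).+1 = size t & wmul (word t) (s_ i) = word u.
Proof.
elim/last_ind: t => [|t j IH] neg.
  by move: neg; rewrite /word big_nil perm1 positive_simple.
have [p|/IH[u su hu]] := boolP (positive (word t (alpha i))); last first.
  exists (rcons u j); first by rewrite !size_rcons su.
  by rewrite !word_rcons -hu /wmul mulgA.
have e : word t (alpha i) = alpha j.
  move: neg; rewrite word_rcons permM; apply: contraNeq.
  exact: positive_wsimple.
exists t; first by rewrite size_rcons.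
have := refl_conj (alpha i) (word_weyl t); rewrite e conjgE => h.
rewrite word_rcons /wmul -[s_ j]h !mulgA mulgK.
by rewrite refl_involutive mul1g.
Qed.

Lemma is_word_lengthP w n :
  reflect (exists2 t, size t = n & w = word t) (is_word_length w n).
Proof.
apply: (iffP existsP) => [[t /eqP ->]|[t st ->]].
  by exists t; rewrite ?size_tuple.
by move/eqP in st; exists (Tuple st).
Qed.

Lemma wlen_word t : (wlen (word t) <= size t)%N.
Proof.
rewrite /wlen; case: pselect => // ex.
by case: ex_minnP => m _; apply; apply/is_word_lengthP; exists t.
Qed.

Lemma wlen_min w : w \in weyl Phi -> exists2 t, size t = wlen w & w = word t.
Proof.
move=> /weyl_word[t ->]; rewrite /wlen; case: pselect => [ex|[]].
  by case: ex_minnP => m /is_word_lengthP.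
by exists (size t); apply/is_word_lengthP; exists t.
Qed.

(** The length counts inversions: in a word of minimal length each letter
    creates an inversion, as otherwise the exchange condition would shorten
    the word. *)
Lemma wlen_ninv w : w \in weyl Phi -> wlen w = ninv w.
Proof.
move=> /wlen_min[t st e]; move: st; rewrite {}e {w}.
elim: t => [|i t IH] st.
  by rewrite -st /word big_nil /ninv inversions1 cards0.
have lt : size t = wlen (word t).
  apply/eqP; rewrite eqn_leq wlen_word andbT.
  have [u su hu] := wlen_min (word_weyl t).
  by rewrite -ltnS -su -[(size u).+1]/(size (i :: u)) -[_.+1]/(size (i :: t))
    st word_cons hu -word_cons wlen_word.
have [p|n] := boolP (positive (word t (alpha i))).
  by rewrite -st word_cons ninv_wmul ?word_weyl //= lt IH.
have [u su hu] := exchange n.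
have := wlen_word u; rewrite -hu -word_cons -st /= -su; lia.
Qed.

Lemma ninv_eq0 w : w \in weyl Phi -> ninv w = 0%N -> w = 1%g.
Proof.
move=> ww; rewrite -wlen_ninv // => e; have [t] := wlen_min ww.
by rewrite e => /size0nil -> ->; rewrite /word big_nil.
Qed.

Lemma wlen_up w i : w \in weyl Phi -> positive (w (alpha i)) ->
  wlen (wmul w (s_ i)) = (wlen w).+1.
Proof.
by move=> ww p; rewrite !wlen_ninv ?wmul_weyl ?wsimple_weyl // ninv_wmul.
Qed.

Lemma wlen_down w i : w \in weyl Phi -> ~~ positive (w (alpha i)) ->
  wlen w = (wlen (wmul w (s_ i))).+1.
Proof.
by move=> ww n; rewrite !wlen_ninv ?wmul_weyl ?wsimple_weyl // -ninv_wmul_neg.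
Qed.

Lemma negative_simple w : (forall i, ~~ positive (w (alpha i))) ->
  w \in weyl Phi -> forall a, positive a -> ~~ positive (w a).
Proof.
move=> neg ww a /positiveP ap; apply/negativeP => k.
rewrite (vec_weyl _ ww) summxE; apply: sumr_le0 => i _; rewrite mxE.
by rewrite mulr_ge0_le0 //; exact/negativeP.
Qed.

Lemma positive_simple_weyl w : (forall i, positive (w (alpha i))) ->
  w \in weyl Phi -> forall a, positive a -> positive (w a).
Proof.
move=> pos ww a /positiveP ap; apply/positiveP => k.
rewrite (vec_weyl _ ww) summxE; apply: sumr_ge0 => i _; rewrite mxE.
by rewrite mulr_ge0 //; exact/positiveP.
Qed.

(** Induction along the weak order: every Weyl group element is reached from 1
    by right multiplications with simple reflections which increase the
    length. *)
Lemma weyl_ind (P : {perm rs_root Phi} -> Prop) :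
    P 1%g ->
    (forall w i, w \in weyl Phi -> positive (w (alpha i)) -> P w ->
      P (wmul w (s_ i))) ->
    forall w, w \in weyl Phi -> P w.
Proof.
move=> P1 PM w; have [n] := ubnP (ninv w); elim: n w => // n IH w hn ww.
have [/forallP pos|] := boolP [forall i, positive (w (alpha i))].
  rewrite (ninv_eq0 ww) //; apply/eqP; rewrite cards_eq0.
  apply/eqP/finset.setP => a; rewrite !inE; apply/negP => /andP[ap].
  by rewrite positive_simple_weyl.
rewrite negb_forall => /existsP[i neg].
have w'W : wmul w (s_ i) \in weyl Phi by rewrite wmul_weyl ?wsimple_weyl.
rewrite -(wmul_wsimpleK w i); apply: PM => //.
  by rewrite positive_wmul.
by apply: IH => //; rewrite -ltnS -ninv_wmul_neg.
Qed.

(** A simple root which w0 maps to a positive root would allow to lengthen w0. *)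
Lemma longest_negative w0 a : longest w0 -> positive (w0 a) = ~~ positive a.
Proof.
move=> [w0W max].
have neg b : positive b -> ~~ positive (w0 b).
  apply: (negative_simple _ w0W) => i; apply/negP => p.
  have := max _ (wmul_weyl w0W (wsimple_weyl i)).
  by rewrite wlen_up // ltnn.
have [/neg/negbTE//|] := boolP (positive a); rewrite -positive_opp => /neg.
by rewrite weyl_opp // positive_opp negbK.
Qed.

Lemma longest_involutive w0 : longest w0 -> (w0 * w0)%g = 1%g.
Proof.
move=> w0l; have [w0W _] := w0l.
apply: ninv_eq0; first exact: groupM.
apply/eqP; rewrite cards_eq0; apply/eqP/finset.setP => a; rewrite !inE permM.
by rewrite !longest_negative // negbK andbN.
Qed.

Lemma wlen_longest w0 : longest w0 ->
  wlen w0 = #|[set a : rs_root Phi | positive a]|.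
Proof.
move=> w0l; have [w0W _] := w0l; rewrite wlen_ninv //; apply: eq_card => a.
by rewrite !inE longest_negative // negbK andbb.
Qed.

(** Conjugation by the longest element preserves the length, so it permutes the
    simple reflections. Hence w0(alpha_i) is proportional to a simple root, and
    it is negative. *)
Lemma longest_simple w0 i : longest w0 ->
  exists j, w0 (alpha i) = opp (alpha j).
Proof.
move=> w0l; have [w0W _] := w0l.
have e : (s_ i ^ w0)%g = rs_refl (w0 (alpha i)) := refl_conj (alpha i) w0W.
have w0V : (w0^-1)%g = w0.
  by rewrite -[LHS]mulg1 -(longest_involutive w0l) mulKg.
have n1 : ninv (s_ i ^ w0) = 1%N.
  rewrite -(cards1 (w0 (opp (alpha i)))); apply: eq_card => a; rewrite !inE.
  rewrite conjgE w0V !permM longest_negative // negbK.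
  have w0K b : w0 (w0 b) = b by rewrite -permM longest_involutive // perm1.
  rewrite -[in positive a](w0K a) longest_negative //.
  rewrite -[a in RHS](w0K a) (inj_eq perm_inj); move: (w0 a) => b.
  apply/andP/eqP => [[bn sp]|->].
    rewrite -positive_opp in bn; rewrite -[b]oppK; congr opp; apply/eqP.
    apply: contraLR sp => /(positive_wsimple bn).
    by rewrite weyl_opp ?wsimple_weyl // positive_opp.
  by rewrite positive_opp positive_simple weyl_opp ?wsimple_weyl // wsimple_alpha
    oppK positive_simple.
have cW : (s_ i ^ w0)%g \in weyl Phi by rewrite groupJ ?wsimple_weyl.
have [[|j [|]]] := wlen_min cW; rewrite wlen_ninv // n1 // => _.
rewrite /word big_seq1 e => /permP/(_ (w0 (alpha i)))/(congr1 (@rs_vec _ _)).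
rewrite -/(opp _) vec_opp rs_vec_refl => h.
exists j; have : 2 *: rs_vec (w0 (alpha i)) =
    pairing (w0 (alpha i)) (alpha j) *: rs_vec (alpha j).
  rewrite -[RHS]opprK -[- (_ *: _)](addKr (rs_vec (w0 (alpha i)))).
  by rewrite -h opprD opprK scaler_nat mulr2n.
move=> /(rs_vec_reduced (isT : 2 != 0 :> int))[|] ej.
  have := positive_simple Phi j.
  by rewrite ej longest_negative // positive_simple.
by rewrite ej oppK.
Qed.

End Length.

Section WeylSigns.
Variables (r : nat) (Phi : rootSystem r).
Implicit Types (a b : rs_root Phi) (i j : 'I_r) (w : {perm rs_root Phi}).
Local Notation alpha := (rs_simple Phi).
Local Notation s_ := (wsimple Phi).

Lemma wsimpleK i : involutive (s_ i).
Proof. exact: reflK. Qed.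

Lemma wsimpleV i : (s_ i)^-1%g = s_ i.
Proof. by apply/eqP; rewrite eq_invg_mul; apply/eqP/refl_involutive. Qed.

Lemma sign_wsimple i a : a != alpha i -> a != opp (alpha i) ->
  positive (s_ i a) = positive a.
Proof.
move=> ai aoi; have [ap|an] := boolP (positive a).
  exact: positive_wsimple.
apply/negbTE; rewrite -positive_opp -weyl_opp ?wsimple_weyl //.
apply: positive_wsimple; first by rewrite positive_opp.
by apply: contra aoi => /eqP <-; rewrite oppK.
Qed.

Lemma weyl_inv_opp w a b : w \in weyl Phi ->
  (w^-1%g a == opp b) = (a == opp (w b)).
Proof.
by move=> wW; rewrite -(inj_eq (@perm_inj _ w)) permKV weyl_opp.
Qed.

Lemma weyl_inv_eq w a b : (w^-1%g a == b) = (a == w b).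
Proof. by rewrite -(inj_eq (@perm_inj _ w)) permKV. Qed.

(** When w(alpha_i) is positive, it is the only positive root which the inverse
    of w s_i makes negative and the inverse of w does not. *)
Lemma prod_coinversions (K : comNzRingType) w i (f : rs_root Phi -> K) :
    w \in weyl Phi -> positive (w (alpha i)) ->
  \prod_(a | positive a && ~~ positive ((wmul w (s_ i))^-1%g a)) f a =
  f (w (alpha i)) * \prod_(a | positive a && ~~ positive (w^-1%g a)) f a.
Proof.
move=> wW wp; rewrite (bigD1 (w (alpha i))) /=; last first.
  rewrite wp /wmul invMg permM permK wsimpleV.
  by rewrite wsimple_alpha positive_opp positive_simple.
congr (_ * _); apply: eq_bigl => a.
have [ap|//] /= := boolP (positive a).
rewrite /wmul invMg permM wsimpleV.
have [->|ai] := eqVneq a (w (alpha i)).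
  by rewrite permK positive_simple andbF.
rewrite andbT sign_wsimple ?weyl_inv_eq ?weyl_opp //.
by apply: contraTneq ap => ->; rewrite positive_opp wp.
Qed.

Lemma wsimple_neq1 i : s_ i != 1%g.
Proof.
apply/eqP => /permP/(_ (alpha i)); rewrite perm1 wsimple_alpha => e.
by have := positive_opp (alpha i); rewrite e positive_simple.
Qed.

Lemma positive_dual a : @positive r (dual Phi) a = positive a.
Proof.
apply/idP/idP => ap.
  apply/positiveP => i.
  by have := @covec_ge0 r (dual Phi) a i ap.
by apply/forallP => i; exact: covec_ge0.
Qed.

End WeylSigns.

(** * Infinite products of complex numbers *)

Local Open Scope classical_set_scope.

Section Modulus.
Variable R : realType.
Local Notation C := (Cx R).
Implicit Types (z : C) (k K e : R).

(** The modulus as a real number, since the norm of C takes its values in C. *)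
Definition cmod z : R := complex.Re `|z|.

Lemma cmodE z : `|z| = (cmod z)%:C%C.
Proof. by rewrite /cmod RRe_real ?normr_real. Qed.

Lemma cmod_ge0 z : 0 <= cmod z.
Proof. by rewrite -ler0c -cmodE. Qed.

Lemma cmodM z1 z2 : cmod (z1 * z2) = cmod z1 * cmod z2.
Proof. by apply: complexI; rewrite rmorphM /= -!cmodE normrM. Qed.

Lemma cmodN z : cmod (- z) = cmod z.
Proof. by rewrite /cmod normrN. Qed.

Lemma cmodV z : cmod z^-1 = (cmod z)^-1.
Proof. by apply: complexI; rewrite fmorphV /= -!cmodE normfV. Qed.

Lemma cmod1 : cmod 1 = 1.
Proof. by rewrite /cmod normr1. Qed.

Lemma cmod_eq0 z : (cmod z == 0) = (z == 0).
Proof. by rewrite -[RHS]normr_eq0 cmodE -(inj_eq (@complexI R)). Qed.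

Lemma cmodX z n : cmod (z ^+ n) = cmod z ^+ n.
Proof. by elim: n => [|n IH]; rewrite ?expr0 ?cmod1 // !exprS cmodM IH. Qed.

Lemma cmodD z1 z2 : cmod (z1 + z2) <= cmod z1 + cmod z2.
Proof. by rewrite -lecR rmorphD /= -!cmodE ler_normD. Qed.

Lemma cmodB z1 z2 : cmod z1 - cmod z2 <= cmod (z1 + z2).
Proof.
by rewrite lerBlDr -(cmodN z2) -{1}(addrK z2 z1) cmodD.
Qed.

Lemma cmod_distC z1 z2 : cmod (z1 - z2) = cmod (z2 - z1).
Proof. by rewrite -cmodN opprB. Qed.

Lemma cmod_Re z : `|complex.Re z| <= cmod z.
Proof. by rewrite -lecR -cmodE normc_ge_Re. Qed.

Lemma cmod_Im z : `|complex.Im z| <= cmod z.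
Proof.
have := cmod_Re (z * 'i%C); rewrite ReiNIm normrN cmodM.
by rewrite [X in _ * X](_ : _ = 1) ?mulr1 // /cmod normc_def /= expr0n /= add0r
  expr1n sqrtr1.
Qed.

Lemma cmod_le_ReIm z : cmod z <= `|complex.Re z| + `|complex.Im z|.
Proof.
have cre (x : R) : cmod (x%:C%C : C) = `|x|.
  by rewrite /cmod normc_def /= expr0n /= addr0 sqrtr_sqr.
rewrite [in cmod z](complexE z); apply: le_trans (cmodD _ _) _.
rewrite cmodM !cre -[X in _ <= _ + X]mul1r lerD2l ler_wpM2r //.
by rewrite /cmod normc_def /= expr0n /= add0r expr1n sqrtr1.
Qed.

Lemma cvg_cmodP (T : Type) (F : set_system T) {FF : Filter F} (f : T -> C)
    (l : C) :
  f x @[x --> F] --> l <->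
  forall e, 0 < e -> \forall x \near F, cmod (l - f x) < e.
Proof.
rewrite cvgrPdist_lt; split=> h e e0.
  have := h e%:C%C; rewrite ltcR => /(_ e0); apply: filterS => x.
  by rewrite cmodE ltcR.
have er : complex.Re e > 0 by move: e0; rewrite ltcE /= => /andP[].
have := h _ er; apply: filterS => x; rewrite -ltcR -cmodE RRe_real //.
exact: gtr0_real.
Qed.

(** Completeness of C, reduced to that of the real line. *)
Lemma cvg_ReIm (u : nat -> C) (x y : R) :
  complex.Re (u n) @[n --> \oo] --> x -> complex.Im (u n) @[n --> \oo] --> y ->
  u n @[n --> \oo] --> ((x +i* y)%C : C).
Proof.
move=> /cvgrPdist_lt hx /cvgrPdist_lt hy; apply/cvg_cmodP => e e0.
have e2 : 0 < e / 2 by rewrite divr_gt0.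
have := hy _ e2; have := hx _ e2; apply: filterS2 => n h1 h2.
apply: le_lt_trans (cmod_le_ReIm _) _.
have -> : complex.Re ((x +i* y)%C - u n) = x - complex.Re (u n) by case: (u n).
have -> : complex.Im ((x +i* y)%C - u n) = y - complex.Im (u n) by case: (u n).
by rewrite (splitr e) ltrD.
Qed.

Lemma cvg_geometric_increments (x : nat -> R) K k : 0 <= k -> k < 1 ->
  (forall n, `|x n.+1 - x n| <= K * k ^+ n) -> cvgn x.
Proof.
move=> k0 k1 hx.
have : cvgn (series (telescope x)).
  apply: normed_cvg; apply: (@series_le_cvg _ _ (geometric K k)) => //=.
  - by move=> n; apply: le_trans (hx n).
  - by apply: is_cvg_geometric_series; rewrite ger0_norm.
have -> : series (telescope x) = fun n => x n - x 0%N.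
  by apply/funext => n; rewrite seriesEnat /= telescope_sumr.
move=> cx; have -> : x = (fun n => (x n - x 0%N) + x 0%N).
  by apply/funext => n; rewrite subrK.
by apply: is_cvgD => //; apply: is_cvg_cst.
Qed.

Lemma cmod_prod_le (a : nat -> C) m n :
  cmod (\prod_(m <= i < n) (1 + a i)) <= expR (\sum_(m <= i < n) cmod (a i)).
Proof.
elim/big_rec2 : _ => [|i s p _ IH]; first by rewrite expR0 cmod1.
rewrite cmodM expRD ler_pM ?cmod_ge0 //.
by apply: le_trans (cmodD _ _) _; rewrite cmod1 expR_ge1Dx.
Qed.

Lemma cmod_prod_ge (a : nat -> C) m n :
    (forall i, (m <= i)%N -> cmod (a i) <= 1) ->
  1 - \sum_(m <= i < n) cmod (a i) <= cmod (\prod_(m <= i < n) (1 + a i)).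
Proof.
move=> a1; have [mn|nm] := leqP m n; last first.
  by rewrite !big_geq ?cmod1 ?subr0 // ltnW.
rewrite -(subnKC mn); elim: (n - m)%N => [|d IH].
  by rewrite addn0 !big_geq // cmod1 subr0.
rewrite addnS !big_nat_recr ?leq_addr //= cmodM.
set S := \sum_(m <= i < m + d) _ in IH *; set P := cmod (\prod_(_ <= _ < _) _) in IH *.
have ai1 := a1 (m + d)%N (leq_addr _ _).
have S0 : 0 <= S by apply: sumr_ge0 => i _; apply: cmod_ge0.
have := cmodB 1 (a (m + d)%N); have := cmod_ge0 (a (m + d)%N); rewrite cmod1.
have P0 : 0 <= P by apply: cmod_ge0.
set A := cmod (a _) in ai1 *; set Q := cmod (1 + _); nra.
Qed.

Lemma geometric_sum_le K k m n : 0 <= K -> 0 <= k -> k < 1 ->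
  \sum_(m <= i < n) K * k ^+ i <= K * k ^+ m / (1 - k).
Proof.
move=> K0 k0 k1; have k1' : 0 < 1 - k by rewrite subr_gt0.
have pos x : 0 <= K * k ^+ x by rewrite mulr_ge0 ?exprn_ge0.
have [mn|nm] := leqP m n; last first.
  by rewrite big_geq ?(ltnW nm) //; apply: divr_ge0; [exact: pos|exact: ltW].
rewrite -(subnKC mn).
rewrite -[leLHS](@addrK _ (K * k ^+ (m + (n - m)) / (1 - k))).
rewrite [X in X - _](_ : _ = K * k ^+ m / (1 - k)).
  by rewrite gerBl divr_ge0 ?(ltW k1').
elim: (n - m)%N => [|d IH]; first by rewrite addn0 big_geq // add0r.
rewrite addnS big_nat_recr ?leq_addr //= -[RHS]IH exprS.
by field; rewrite gt_eqF.
Qed.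

(** The partial products are bounded, so their increments decrease geometrically.
    Beyond some rank the tail of the product stays at a distance at least 1/2
    from 0, so that the limit vanishes only if one of its factors does. *)
Lemma infinite_product (a : nat -> C) K k : 0 <= K -> 0 <= k -> k < 1 ->
    (forall n, cmod (a n) <= K * k ^+ n) ->
  exists l : C, (\prod_(0 <= n < N) (1 + a n)) @[N --> \oo] --> l /\
    ((forall n, 1 + a n != 0) -> l != 0).
Proof.
move=> K0 k0 k1 ha; set u := fun N => \prod_(0 <= n < N) (1 + a n).
have k1' : 0 < 1 - k by rewrite subr_gt0.
have sum_le m n : \sum_(m <= i < n) cmod (a i) <= K * k ^+ m / (1 - k).
  by apply: le_trans (geometric_sum_le m n K0 k0 k1); apply: ler_sum.
have uB n : cmod (u n) <= expR (K / (1 - k)).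
  apply: le_trans (cmod_prod_le _ _ _) _; rewrite ler_expR.
  by have := sum_le 0%N n; rewrite expr0 mulr1.
have du n : cmod (u n.+1 - u n) <= expR (K / (1 - k)) * K * k ^+ n.
  rewrite /u big_nat_recr //= -/(u n) mulrDr mulr1 addrC addKr cmodM -mulrA.
  by rewrite ler_pM ?cmod_ge0.
have cR : cvgn (fun n => complex.Re (u n)).
  apply: cvg_geometric_increments k0 k1 _ => n; apply: le_trans (du n).
  by apply: le_trans (cmod_Re _); case: (u n.+1) (u n) => ? ? [].
have cI : cvgn (fun n => complex.Im (u n)).
  apply: cvg_geometric_increments k0 k1 _ => n; apply: le_trans (du n).
  by apply: le_trans (cmod_Im _); case: (u n.+1) (u n) => ? ? [].
set l : C := (lim (complex.Re (u n) @[n --> \oo]) +i*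
  lim (complex.Im (u n) @[n --> \oo]))%C.
have ul : u n @[n --> \oo] --> l by exact: cvg_ReIm.
exists l; split=> // a0.
(* the sum of the tail beyond m is at most 1/2 *)
have [m hm] : exists m, K * k ^+ m / (1 - k) <= 1 / 2.
  have : (K / (1 - k) * k ^+ n) @[n --> \oo] --> K / (1 - k) * 0.
    by apply: cvgM; [exact: cvg_cst|apply: cvg_expr; rewrite ger0_norm].
  rewrite mulr0 => /cvgrPdist_lt/(_ (1/2))[//|m _ hm].
  exists m; have := hm m (leqnn _); rewrite /= sub0r normrN.
  rewrite mulrAC => h; apply: le_trans (ltW h); exact: ler_norm.
have um0 : 0 < cmod (u m).
  rewrite lt_def cmod_ge0 andbT cmod_eq0 prodf_seq_neq0.
  by apply/allP => i _; exact: a0.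
apply/eqP => l0; move/cvg_cmodP: ul => /(_ (cmod (u m) / 2)).
rewrite divr_gt0 // => /(_ isT)[n _ hn].
have := hn (maxn m n) (leq_maxr _ _); rewrite /= l0 sub0r cmodN.
rewrite /u (@big_cat_nat _ _ _ m) ?leq_maxl //= cmodM -/(u m).
have := @cmod_prod_ge a m (maxn m n); set P := cmod (\prod_(m <= _ < _) _).
have := sum_le m (maxn m n); set S := \sum_(_ <= _ < _) _ => hS hP.
suff : 1 - S <= P by nra.
apply: hP => i mi; apply: le_trans (ha i) _; apply: le_trans (_ : K * k ^+ m <= _).
  by rewrite ler_wpM2l // ler_wiXn2l // ltW.
move: hm; rewrite ler_pdivrMr //; nra.
Qed.

(** Changing the factors one after the other: the i-th change contributes the
    difference of the i-th factors times a product of the [1 + b j] before it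
    and of the [1 + a j] after it. *)
Lemma cmod_prodB_le (a b : nat -> C) (B : R) n :
    (forall i, cmod (\prod_(0 <= j < i) (1 + b j)) <= B) ->
  cmod (\prod_(0 <= i < n) (1 + a i) - \prod_(0 <= i < n) (1 + b i)) <=
  expR (\sum_(0 <= i < n) cmod (a i)) * (B * \sum_(0 <= i < n) cmod (a i - b i)).
Proof.
move=> hB; elim: n => [|n IH].
  by rewrite !big_geq // subrr mulr0 mulr0 /cmod normr0.
have B0 : 0 <= B by apply: le_trans (hB 0%N); apply: cmod_ge0.
rewrite !big_nat_recr //=.
set Pa := \prod_(0 <= i < n) (1 + a i) in IH *; have := hB n.
set Pb := \prod_(0 <= i < n) (1 + b i) in IH * => hPb.
set S := \sum_(0 <= i < n) cmod (a i) in IH *.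
set D := \sum_(0 <= i < n) cmod (a i - b i) in IH *.
have -> : Pa * (1 + a n) - Pb * (1 + b n) = (Pa - Pb) * (1 + a n) + Pb * (a n - b n).
  ring.
apply: le_trans (cmodD _ _) _; rewrite !cmodM !mulrDr; apply: lerD.
  rewrite expRD [leRHS]mulrAC; apply: ler_pM; rewrite ?cmod_ge0 //.
  by apply: le_trans (cmodD _ _) _; rewrite cmod1 expR_ge1Dx.
rewrite -[leLHS]mul1r; apply: ler_pM => //; rewrite ?mulr_ge0 ?cmod_ge0 //.
  rewrite -expR0 ler_expR addr_ge0 ?cmod_ge0 //.
  by apply: sumr_ge0 => i _; apply: cmod_ge0.
by rewrite ler_wpM2r ?cmod_ge0.
Qed.

End Modulus.

(** * The theta function *)

Section Theta.
Variables (R : realType) (q : Cx R).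
Hypotheses (q0 : q != 0) (q1 : `|q| < 1).
Local Notation C := (Cx R).
Implicit Types x y a b : C.

Definition theta_prod x : C :=
  lim ((\prod_(1 <= n < N.+1) ((1 - q ^+ n * x) * (1 - q ^+ n / x))) @[N --> \oo]).

Lemma theta_prodV x : theta_prod x^-1 = theta_prod x.
Proof.
rewrite /theta_prod (_ : (fun N => _) = fun N =>
  \prod_(1 <= n < N.+1) ((1 - q ^+ n * x) * (1 - q ^+ n / x))) //.
by apply/funext => N; apply: eq_bigr => n _; rewrite invrK mulrC.
Qed.

Lemma cmod_q_lt1 : cmod q < 1.
Proof. by rewrite -ltcR -cmodE. Qed.

(** The factor of index n + 1 of the product is [1 + theta_term x n]. *)
Definition theta_term x n : C := q ^+ n.+1 * (q ^+ n.+1 - (x + x^-1)).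

Lemma theta_factorE x N : x != 0 ->
  \prod_(1 <= n < N.+1) ((1 - q ^+ n * x) * (1 - q ^+ n / x)) =
  \prod_(0 <= n < N) (1 + theta_term x n).
Proof.
move=> x0; rewrite big_add1 /=; apply: eq_bigr => n _; rewrite /theta_term.
by field.
Qed.

Lemma cmod_theta_term x n :
  cmod (theta_term x n) <= (1 + cmod x + cmod x^-1) * cmod q ^+ n.
Proof.
have k0 := cmod_ge0 q; have k1 := ltW cmod_q_lt1.
rewrite cmodM cmodX mulrC ler_pM ?cmod_ge0 ?exprn_ge0 //; last first.
  by rewrite ler_wiXn2l.
apply: le_trans (cmodD _ _) _; rewrite cmodN cmodX -addrA lerD ?cmodD //.
by rewrite exprn_ile1.
Qed.

Lemma theta_prod_cvg x : x != 0 ->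
  \prod_(0 <= n < N) (1 + theta_term x n) @[N --> \oo] --> theta_prod x /\
  ((forall n, 1 + theta_term x n != 0) -> theta_prod x != 0).
Proof.
move=> x0.
have [||||l [xl l0]] := @infinite_product _ (theta_term x)
  (1 + cmod x + cmod x^-1) (cmod q).
- by rewrite !addr_ge0 ?cmod_ge0.
- exact: cmod_ge0.
- exact: cmod_q_lt1.
- exact: cmod_theta_term.
suff -> : theta_prod x = l by [].
rewrite /theta_prod; apply: cvg_lim; first exact: norm_hausdorff.
rewrite (_ : (fun N => _) = fun N => \prod_(0 <= n < N) (1 + theta_term x n)) //.
by apply/funext => N; exact: theta_factorE.
Qed.

(** Membership in the set of integral powers of q, the zeros of theta, stated
    with natural exponents. *)
Definition qpower x := exists n, q ^+ n * x = 1 \/ q ^+ n = x.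

Lemma theta_term_neq0 x n : x != 0 -> q ^+ n.+1 * x != 1 -> q ^+ n.+1 != x ->
  1 + theta_term x n != 0.
Proof.
move=> x0 h1 h2.
have -> : 1 + theta_term x n = (1 - q ^+ n.+1 * x) * (1 - q ^+ n.+1 / x).
  by rewrite /theta_term; field.
rewrite mulf_neq0 // subr_eq0 eq_sym //; apply: contraNneq h2 => e.
by rewrite -[q ^+ _](divfK x0) e mul1r.
Qed.

Lemma theta_prod_neq0 x : x != 0 -> ~ qpower x -> theta_prod x != 0.
Proof.
move=> x0 nq; apply: (theta_prod_cvg x0).2 => n.
by apply: theta_term_neq0 => //; apply/eqP => e; apply: nq; exists n.+1; auto.
Qed.

Lemma theta_prod1_neq0 : theta_prod 1 != 0.
Proof.
have qn n : q ^+ n.+1 != 1.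
  apply/eqP => /(congr1 (@cmod R)); rewrite cmodX cmod1 => e.
  have : cmod q ^+ n.+1 < 1 by rewrite exprn_ilt1 ?cmod_ge0 ?cmod_q_lt1.
  by rewrite e ltxx.
by apply: (theta_prod_cvg (oner_neq0 _)).2 => n; apply: theta_term_neq0;
  rewrite ?mulr1 ?oner_neq0.
Qed.

(** The partial products are Lipschitz at 1, uniformly in the number of factors:
    the factors at x and at 1 differ by q^n (x - 1)^2 / x. *)
Lemma theta_prod_cvg1 : theta_prod x @[x --> (1 : C)] --> theta_prod 1.
Proof.
have k0 := cmod_ge0 q; have k1 := cmod_q_lt1.
have k1' : 0 < 1 - cmod q by rewrite subr_gt0.
(* 1 + |x| + 1/|x| is 3 at x = 1, and at most 6 if |x - 1| < 1/2 *)
pose B : R := expR (3 / (1 - cmod q)).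
pose K : R := expR (6 / (1 - cmod q)) * (B * (2 / (1 - cmod q))).
have K0 : 0 < K by rewrite !mulr_gt0 ?expR_gt0 ?invr_gt0.
have sum_le x M N : 1 + cmod x + cmod x^-1 <= M ->
    \sum_(0 <= i < N) cmod (theta_term x i) <= M / (1 - cmod q).
  move=> hM; have M0 : 0 <= M.
    by apply: le_trans hM; rewrite !addr_ge0 ?cmod_ge0.
  have := geometric_sum_le 0 N M0 k0 k1; rewrite expr0 mulr1; apply: le_trans.
  apply: ler_sum => i _; apply: le_trans (cmod_theta_term _ _) _.
  by rewrite ler_wpM2r ?exprn_ge0.
have lip x : cmod (x - 1) < 1 / 2 ->
    cmod (theta_prod 1 - theta_prod x) <= K * cmod (x - 1).
  move=> hx; have x1 : 1 / 2 < cmod x.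
    by have := cmodB 1 (x - 1); rewrite [1 + (x - 1)]addrC subrK cmod1; lra.
  have x2 : cmod x < 3 / 2.
    by have := cmodD 1 (x - 1); rewrite [1 + (x - 1)]addrC subrK cmod1; lra.
  have x0 : x != 0 by rewrite -cmod_eq0 gt_eqF //; lra.
  have xV : cmod x^-1 <= 2.
    rewrite cmodV -[2]invrK lef_pV2 ?posrE ?invr_gt0 //; lra.
  have part N : cmod (\prod_(0 <= n < N) (1 + theta_term x n) -
      \prod_(0 <= n < N) (1 + theta_term 1 n)) <= K * cmod (x - 1).
    apply: le_trans (@cmod_prodB_le _ _ (theta_term 1) B N _) _.
      move=> i; apply: le_trans (cmod_prod_le _ _ _) _; rewrite ler_expR.
      by apply: sum_le; rewrite invr1 cmod1; lra.
    rewrite /K -mulrA ler_pM ?expR_ge0 //.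
    - rewrite mulr_ge0 ?expR_ge0 //; apply: sumr_ge0 => i _; exact: cmod_ge0.
    - by rewrite ler_expR; apply: sum_le; lra.
    rewrite -mulrA ler_wpM2l ?expR_ge0 //.
    have d2 : 0 <= 2 * cmod (x - 1) by rewrite mulr_ge0 ?cmod_ge0.
    have := geometric_sum_le 0 N d2 k0 k1.
    rewrite expr0 mulr1 mulrAC; apply: le_trans.
    apply: ler_sum => i _.
    have -> : theta_term x i - theta_term 1 i = - (q ^+ i.+1 * (x - 1) * (x - 1) * x^-1).
      by rewrite /theta_term; field.
    rewrite cmodN !cmodM cmodX exprS.
    have := cmod_ge0 (x - 1); have := cmod_ge0 (x^-1).
    have := exprn_ge0 i k0; set d := cmod (x - 1) in hx *.
    set m := cmod q ^+ i; set v := cmod x^-1 in xV * => m0 v0 d0.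
    have dv : d * v <= 1 by nra.
    have : cmod q * m <= m by nra.
    have : 0 <= cmod q * m by rewrite mulr_ge0.
    set Q := cmod q * m => Q0 Qm; have -> : Q * d * d * v = (Q * d) * (d * v) by ring.
    have : 0 <= Q * d by rewrite mulr_ge0.
    have : Q * d <= m * d by rewrite ler_wpM2r.
    nra.
  apply/ler_addgt0Pr => e e0.
  have /cvg_cmodP/(_ (e / 2)) := (theta_prod_cvg x0).1.
  have /cvg_cmodP/(_ (e / 2)) := (theta_prod_cvg (oner_neq0 C)).1.
  rewrite divr_gt0 // => /(_ isT)[N1 _ h1] /(_ isT)[N2 _ h2].
  have := h1 (maxn N1 N2) (leq_maxl _ _); have := h2 (maxn N1 N2) (leq_maxr _ _).
  have /= := part (maxn N1 N2).
  set px := \prod_(0 <= n < _) (1 + theta_term x n).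
  set p1 := \prod_(0 <= n < _) (1 + theta_term 1 n) => h h2' h1'.
  have -> : theta_prod 1 - theta_prod x =
    (theta_prod 1 - p1) + ((p1 - px) + (px - theta_prod x)) by ring.
  have := cmodD (theta_prod 1 - p1) ((p1 - px) + (px - theta_prod x)).
  have := cmodD (p1 - px) (px - theta_prod x).
  rewrite (cmod_distC p1) (cmod_distC px (theta_prod x)); lra.
apply/(@cvg_cmodP _ _ (nbhs (1 : C))) => e e0.
have m0 : 0 < Num.min (1 / 2) (e / K) by rewrite lt_min !divr_gt0.
have /cvg_cmodP/(_ _ m0) : (fun x : C => x) y @[y --> (1 : C)] --> (1 : C) by exact: cvg_id.
apply: filterS => x; rewrite cmod_distC lt_min => /andP[h1 h2].
apply: le_lt_trans (lip x h1) _; move: h2; rewrite ltr_pdivlMr //; nra.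
Qed.

(** The principal square root y of x has a nonnegative real part, so that
    |1 + y| >= 1 in the factorization 1 - x = (1 - y) (1 + y). *)
Lemma sqrtc_cvg1 : (sqrtc x : C) @[x --> (1 : C)] --> (1 : C).
Proof.
apply/(@cvg_cmodP _ _ (nbhs (1 : C))) => e e0.
have /cvg_cmodP/(_ _ e0) : (fun x : C => x) y @[y --> (1 : C)] --> (1 : C) by exact: cvg_id.
apply: filterS => x; apply: le_lt_trans.
set y : C := sqrtc x.
have yx : y ^+ 2 = x := sqr_sqrtc x.
have -> : 1 - x = (1 - y) * (1 + y) by rewrite -yx; ring.
rewrite cmodM ler_peMr ?cmod_ge0 //; apply: le_trans (cmod_Re _).
have : 0 <= complex.Re y by rewrite /y; case: (x) => u v /=; exact: sqrtr_ge0.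
case: y yx => u v _ /= u0; rewrite ger0_norm; lra.
Qed.

(** theta(x) is x^(1/2) (1 - 1/x) times a function continuous at 1, so its
    derivative at 1 is the value of that function. *)
Lemma theta_derive1 : derive1 (theta q) 1 = theta_prod 1.
Proof.
rewrite /derive1; apply: cvg_lim; first exact: norm_hausdorff.
have t1 : theta q 1 = 0 by rewrite /theta /theta_br invr1 subrr mulr0 mul0r.
have h : sqrtc x / x * theta_prod x @[x --> (1 : C)] --> theta_prod 1.
  rewrite -[X in _ --> X]mul1r; apply: cvgM theta_prod_cvg1.
  rewrite -[X in _ --> X](divr1 1); apply: cvgM sqrtc_cvg1 _.
  by apply: cvgV; [exact: oner_neq0|exact: cvg_id].
have h1 : (h + 1) @[h --> (0 : C)^'] --> (1 : C).
  apply: cvg_trans (cvg_app _ (@nbhs_dnbhs _ _)) _.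
  rewrite -[X in _ --> X]add0r; apply: cvgD; [exact: cvg_id|exact: cvg_cst].
have := cvg_comp _ _ h1 h; apply: cvg_trans; apply: near_eq_cvg.
have hne : \forall h \near (0 : C)^', h + 1 != 0.
  have /cvg_cmodP/(_ 1 ltr01) := h1; apply: filterS => x xs.
  by apply: contraTneq xs => ->; rewrite subr0 cmod1 ltxx.
near=> x; rewrite /= t1 subr0 /theta /theta_br -/(theta_prod _).
have x0 : x != 0 by near: x; exact: nbhs_dnbhs_neq.
have x1 : x + 1 != 0 by near: x.
rewrite -[_ *: _]/(_ * _); field; by rewrite x0 x1.
Unshelve. all: by end_near. Qed.

(** The square roots cancel, so that delta is a single-valued function. *)
Lemma deltaE a b : a != 0 -> b != 0 ->
  delta q a b = (1 - (a * b)^-1) * theta_prod (a * b) * theta_prod 1 /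
    ((1 - a^-1) * theta_prod a * ((1 - b^-1) * theta_prod b)).
Proof.
move=> a0 b0; rewrite /delta theta_derive1 /theta /theta_br.
rewrite -!/(theta_prod _).
have sa : sqrtc a != 0 :> C by rewrite sqrtc_eq0.
have sb : sqrtc b != 0 :> C by rewrite sqrtc_eq0.
have cancel (y z n u v : C) : y != 0 -> z != 0 ->
    y * z * n / (y * u * (z * v)) = n / (u * v).
  move=> y0 z0; rewrite !invfM; move: (u^-1) (v^-1) => u' v'.
  by field; rewrite y0 z0.
by rewrite -[in RHS](cancel _ _ _ _ _ sa sb) !mulrA.
Qed.

Lemma deltaC a b : delta q a b = delta q b a.
Proof.
by rewrite /delta [sqrtc b * _]mulrC [b * a]mulrC [theta q b * _]mulrC.
Qed.

End Theta.

(** * Symmetry and zeros of delta *)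

Section Delta.
Variables (R : realType) (q : Cx R).
Hypotheses (q0 : q != 0) (q1 : `|q| < 1).
Local Notation C := (Cx R).
Implicit Types x y a b : C.

(** Inverting the arguments replaces each 1 - 1/x by 1 - x = - x (1 - 1/x); of
    the three monomials - ab, - a, - b only a sign remains. *)
Lemma delta_inv a b : a != 0 -> b != 0 ->
  delta q a^-1 b^-1 = - delta q a b.
Proof.
move=> a0 b0; rewrite !deltaE ?invr_eq0 // -invfM !theta_prodV !invrK.
have sub1 (x : C) : x != 0 -> 1 - x = - x * (1 - x^-1) by move=> x0; field.
have cancel (y z n u v : C) : y != 0 -> z != 0 ->
    y * z * n / (y * u * (z * v)) = n / (u * v).
  move=> y0 z0; rewrite !invfM; move: (u^-1) (v^-1) => u' v'.
  by field; rewrite y0 z0.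
rewrite (sub1 a) // (sub1 b) // (sub1 (a * b)) ?mulf_neq0 //.
rewrite -[RHS]mulNr -[RHS](cancel (- a) (- b)) ?oppr_eq0 //.
by congr (_ * _^-1); ring.
Qed.

Lemma delta_neq0 a b : a != 0 -> b != 0 -> ~ qpower q a -> ~ qpower q b ->
  ~ qpower q (a * b) -> delta q a b != 0.
Proof.
have sub1 x : ~ qpower q x -> 1 - x^-1 != 0.
  move=> nx; apply/eqP => /eqP; rewrite subr_eq0 eq_sym invr_eq1 => /eqP x1.
  by apply: nx; exists 0%N; right; rewrite expr0.
move=> a0 b0 na nb nab; have ab0 := mulf_neq0 a0 b0.
have Pa := theta_prod_neq0 q1 a0 na; have Pb := theta_prod_neq0 q1 b0 nb.
have Pab := theta_prod_neq0 q1 ab0 nab; have P1 := theta_prod1_neq0 q1.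
have sa := sub1 _ na; have sb := sub1 _ nb; have sab := sub1 _ nab.
rewrite deltaE // (mulf_neq0 (mulf_neq0 (mulf_neq0 sab Pab) P1)) //.
by rewrite invr_eq0 (mulf_neq0 (mulf_neq0 sa Pa) (mulf_neq0 sb Pb)).
Qed.

(** The powers of q accumulate at 0 and at infinity only: near x0 all but
    finitely many of them are too small or too large. *)
Lemma near_not_qpower x0 : x0 != 0 ->
  \forall x \near x0, x != x0 -> ~ qpower q x.
Proof.
move=> x0n; have k0 := cmod_ge0 q; have k1 := cmod_q_lt1 q1.
have c0 : 0 < cmod x0 by rewrite lt_def cmod_eq0 x0n cmod_ge0.
have near_neq (c : C) : \forall x \near x0, x != x0 -> x != c.
  have [->|cx] := eqVneq c x0; first by apply: filterE.
  have e0 : 0 < cmod (x0 - c) by rewrite lt_def cmod_eq0 subr_eq0 eq_sym cx cmod_ge0.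
  have /cvg_cmodP/(_ _ e0) : (fun x : C => x) y @[y --> x0] --> x0 by exact: cvg_id.
  by apply: filterS => x h _; apply: contraTneq h => ->; rewrite ltxx.
(* for n >= N, q^n is smaller than x and than 1/x *)
have [N hN] : exists N, forall n, (N <= n)%N -> cmod q ^+ n < cmod x0 / 2 /\
    cmod q ^+ n * (cmod x0 + cmod x0 / 2) < 1.
  have /cvgrPdist_lt h : cmod q ^+ n @[n --> \oo] --> (0 : R).
    by apply: cvg_expr; rewrite ger0_norm.
  have e1 : 0 < cmod x0 / 2 by rewrite divr_gt0.
  have e2 : 0 < (cmod x0 + cmod x0 / 2)^-1 by rewrite invr_gt0 addr_gt0.
  have [N1 _ h1] := h _ e1; have [N2 _ h2] := h _ e2.
  exists (maxn N1 N2) => n; rewrite geq_max => /andP[n1 n2]; split.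
    by have := h1 n n1; rewrite /= sub0r normrN ger0_norm ?exprn_ge0.
  have := h2 n n2; rewrite /= sub0r normrN ger0_norm ?exprn_ge0 // => h3.
  by rewrite -ltr_pdivlMr ?addr_gt0 // div1r.
have small : \forall x \near x0, cmod (x0 - x) < cmod x0 / 2.
  have /cvg_cmodP : (fun x : C => x) y @[y --> x0] --> x0 by exact: cvg_id.
  by apply; rewrite divr_gt0.
have finite : \forall x \near x0, forall i : 'I_N,
    x != x0 -> x != q ^+ i /\ x != (q ^+ i)^-1.
  apply: (@filter_forall _ _ (fun (i : 'I_N) x =>
    x != x0 -> x != q ^+ i /\ x != (q ^+ i)^-1) (nbhs x0)) => i.
  have := near_neq (q ^+ i)^-1; have := near_neq (q ^+ i).
  by apply: filterS2 => x h1 h2 xn; split; [exact: h1|exact: h2].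
move: small finite; apply: filterS2 => x sx fx xn [n].
have [Nn|nN] := leqP N n; last first.
  have [/eqP h1 /eqP h2] := fx (Ordinal nN) xn => -[h|h]; last exact: h1.
  by apply: h2; apply: (mulfI (expf_neq0 n q0)); rewrite h divff // expf_neq0.
have [h1 h2] := hN n Nn.
have xb := cmodB x0 (x - x0); have xa := cmodD x0 (x - x0).
rewrite addrC subrK (cmod_distC x) in xa.
rewrite [x0 + _]addrC subrK (cmod_distC x) in xb.
case=> /(congr1 (@cmod R)); rewrite ?cmodM cmodX ?cmod1 => e; last by lra.
have : cmod q ^+ n * cmod x <= cmod q ^+ n * (cmod x0 + cmod x0 / 2).
  by rewrite ler_wpM2l ?exprn_ge0 //; lra.
by rewrite e; lra.
Qed.

End Delta.

(** * Generic points of the product of the tori *)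

Section Generic.
Variables (R : realType) (r : nat).
Local Notation C := (Cx R).
Local Notation point := ('rV[C]_r * 'rV[C]_r * C)%type.
Local Notation dom := (@domain R r).

Lemma torus_near (t : 'rV[C]_r) : torus t -> \forall u \near t, torus u.
Proof.
move=> tT; apply: (@filter_forall _ _ (fun i (u : 'rV[C]_r) => u 0 i != 0) (nbhs t)) => i.
have e0 : 0 < `|t 0 i| by rewrite normr_gt0 tT.
have /cvgrPdist_lt/(_ _ e0) := @coord_continuous _ _ _ 0 i t.
apply: filterS => u; apply: contraTneq => ->.
by rewrite subr0 ltxx.
Qed.

Lemma cvg_point (T : Type) (F : set_system T) {FF : Filter F}
    (f : T -> point) (p : point) :
  (f x).1.1 @[x --> F] --> p.1.1 -> (f x).1.2 @[x --> F] --> p.1.2 ->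
  (f x).2 @[x --> F] --> p.2 -> f x @[x --> F] --> p.
Proof.
case: p => [[t u] h] /= c1 c2 c3.
rewrite (_ : f = fun x => ((f x).1.1, (f x).1.2, (f x).2)); last first.
  by apply/funext => x; case: (f x) => [[]].
have c12 : ((f x).1.1, (f x).1.2) @[x --> F] --> (t, u).
  exact: (@cvg_pair _ _ _ _ (nbhs t) (nbhs u) _ _ _ _ _ c1 c2).
exact: (@cvg_pair _ _ _ _ (nbhs (t, u)) (nbhs h) _ _ _ _ _ c12 c3).
Qed.

Lemma cvg_point11 (p : point) : x.1.1 @[x --> p] --> p.1.1.
Proof.
case: p => [[t u] h].
exact: (cvg_comp _ _ (@cvg_fst _ _ (nbhs (t, u)) (nbhs h) _)
  (@cvg_fst _ _ (nbhs t) (nbhs u) _)).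
Qed.

Lemma cvg_point12 (p : point) : x.1.2 @[x --> p] --> p.1.2.
Proof.
case: p => [[t u] h].
exact: (cvg_comp _ _ (@cvg_fst _ _ (nbhs (t, u)) (nbhs h) _)
  (@cvg_snd _ _ (nbhs t) (nbhs u) _)).
Qed.

Lemma cvg_point2 (p : point) : x.2 @[x --> p] --> p.2.
Proof. by case: p => [tu h]; exact: cvg_snd. Qed.

Lemma domain_near p : dom p -> \forall x \near p, dom x.
Proof.
move=> [tT uT h0].
have ht : \forall x \near p, torus x.1.1 by exact: cvg_point11 (torus_near tT).
have hu : \forall x \near p, torus x.1.2 by exact: cvg_point12 (torus_near uT).
have hh : \forall x \near p, x.2 != 0.
  have e0 : 0 < `|p.2| by rewrite normr_gt0.
  have /cvgrPdist_lt/(_ _ e0) := @cvg_point2 p; apply: filterS => x.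
  by apply: contraTneq => ->; rewrite subr0 ltxx.
by move: ht hu hh; apply: filterS3 => x; split.
Qed.

(** Equality of meromorphic functions means that the set of points where the
    values agree is generic. Generic sets form a filter: finitely many
    equalities can be used at a common point. *)
Definition generic : set_system point := fun A => dom `<=` closure A°.

Global Instance generic_filter : Filter generic.
Proof.
split.
- by move=> p _ B /nbhs_singleton pB; exists p; split=> //; exact: filterT.
- move=> A B gA gB p dp U pU.
  have [y [Ay [Uy dy]]] := gA p dp _ (filterI (nbhs_interior pU) (domain_near dp)).
  have yAU : nbhs y (A° `&` U) by apply: filterI => //; exact: nbhs_interior.
  have [z [Bz [Az Uz]]] := gB y dy _ yAU.
  by exists z; split=> //; rewrite interiorI.
move=> A B AB gA p dp; apply: closureS (gA p dp) => x; exact: filterS.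
Qed.

Lemma generic_domain : \forall p \near generic, dom p.
Proof. by move=> p dp; apply: subset_closure; exact: domain_near. Qed.

(** A homeomorphism of the domain pulls generic sets back to generic sets. It is
    only required to be one on the domain, because monomial maps are
    discontinuous at points with a zero coordinate. *)
Lemma generic_preimage (f g : point -> point) (A : set point) :
    (forall p, dom p -> dom (f p)) -> (forall p, dom p -> dom (g p)) ->
    (forall p, dom p -> {for p, continuous f}) ->
    (forall p, dom p -> {for p, continuous g}) ->
    (forall p, dom p -> g (f p) = p) -> (forall p, dom p -> f (g p) = p) ->
  generic A -> \forall p \near generic, A (f p).
Proof.
move=> fd gd fc gc gf fg gA p dp U pU.
have gU : nbhs (f p) (g @^-1` U) by apply: gc; [exact: fd|rewrite gf].
have [y [Ay [/= Uy dy]]] := gA _ (fd _ dp) _ (filterI gU (domain_near (fd _ dp))).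
exists (g y); split=> //.
by apply: (fc _ (gd _ dy)); rewrite fg.
Qed.

Lemma cvg_row (T : Type) (F : set_system T) {FF : Filter F}
    (f : T -> 'rV[C]_r) (t : 'rV[C]_r) :
  (forall j, f x 0 j @[x --> F] --> t 0 j) -> f x @[x --> F] --> t.
Proof.
move=> h A [P hP PA]; rewrite nbhs_filterE /fmap /=.
have hF : \forall x \near F, forall j, P 0 j (f x 0 j).
  apply: (@filter_forall _ _ (fun j x => P 0 j (f x 0 j)) F) => j.
  exact: h (hP 0 j).
by apply: filterS hF => x hx; apply: PA => i j; rewrite ord1.
Qed.

Lemma exprz_cvg (T : Type) (F : set_system T) {FF : Filter F}
    (f : T -> C) (a : C) (n : int) :
  a != 0 -> f x @[x --> F] --> a -> exprz (f x) n @[x --> F] --> exprz a n.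
Proof.
move=> a0 fa.
have pos m : f x ^+ m @[x --> F] --> a ^+ m.
  elim: m => [|m IH]; first exact: cvg_cst.
  rewrite exprS (_ : (fun x => _) = (fun x => f x * f x ^+ m)).
    exact: (cvgM fa IH).
  by apply/funext => x; rewrite exprS.
case: n => m; first exact: pos.
by apply: cvgV (pos _); rewrite expf_neq0.
Qed.

Lemma prod_cvg (T : Type) (F : set_system T) {FF : Filter F}
    (f : 'I_r -> T -> C) (a : 'I_r -> C) :
  (forall i, f i x @[x --> F] --> a i) ->
  \prod_i f i x @[x --> F] --> \prod_i a i.
Proof.
by move=> h; apply: cvg_big => //; exact: mul_continuous.
Qed.

Lemma monomial_cvg (T : Type) (F : set_system T) {FF : Filter F}
    (f : T -> 'rV[C]_r) (t : 'rV[C]_r) (e : 'I_r -> int) : torus t -> f x @[x --> F] --> t ->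
  \prod_i exprz (f x 0 i) (e i) @[x --> F] --> \prod_i exprz (t 0 i) (e i).
Proof.
move=> tT ft; apply: prod_cvg => i; apply: exprz_cvg (tT i) _.
exact: (cvg_comp _ _ ft (@coord_continuous _ _ _ 0 i t)).
Qed.

End Generic.

(** * The Weyl group action on the tori *)

Section TorusAction.
Variables (R : realType) (r : nat) (Phi : rootSystem r).
Local Notation C := (Cx R).
Implicit Types (t : 'rV[C]_r) (w : {perm rs_root Phi}) (a : rs_root Phi).

Lemma tactE w t j :
  tact w t 0 j = \prod_i exprz (t 0 i) (rs_covec (w (rs_simple Phi i)) 0 j).
Proof. by rewrite mxE. Qed.

Lemma torus_tact w t : torus t -> torus (tact w t).
Proof.
by move=> tT j; rewrite tactE; apply/prodf_neq0 => i _; apply: expfz_neq0.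
Qed.

Lemma torus_tinv t : torus t -> torus (tinv t).
Proof. by move=> tT j; rewrite mxE invr_eq0. Qed.

Lemma tinvK t : tinv (tinv t) = t.
Proof. by apply/rowP => j; rewrite !mxE invrK. Qed.

Lemma tact_cvg w t : torus t -> tact w u @[u --> t] --> tact w t.
Proof.
move=> tT; apply: (@cvg_row _ _ _ (nbhs t)) => j; rewrite tactE.
rewrite (_ : (fun x => _) = fun x : 'rV[C]_r =>
  \prod_i exprz (x 0 i) (rs_covec (w (rs_simple Phi i)) 0 j)).
  by exact: (@monomial_cvg _ _ _ (nbhs t) _ id t _ tT cvg_id).
by apply/funext => x; rewrite tactE.
Qed.

Lemma tinv_cvg t : torus t -> tinv u @[u --> t] --> tinv t.
Proof.
move=> tT; apply: (@cvg_row _ _ _ (nbhs t)) => j; rewrite mxE.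
rewrite (_ : (fun x => _) = fun x : 'rV[C]_r => (x 0 j)^-1).
  by apply: (@cvgV _ _ (nbhs t)) => //; exact: coord_continuous.
by apply/funext => x; rewrite mxE.
Qed.

Lemma monomial_comp t (e : 'I_r -> 'I_r -> int) (n : 'I_r -> int) : torus t ->
  \prod_j exprz (\prod_i exprz (t 0 i) (e i j)) (n j) =
  \prod_i exprz (t 0 i) (\sum_j e i j * n j).
Proof.
move=> tT.
have sum_exp (x : C) (f : 'I_r -> int) : x != 0 ->
    exprz x (\sum_j f j) = \prod_j exprz x (f j).
  move=> x0; elim/big_rec2: _ => [|j y z _ <-]; first by rewrite expr0z.
  by rewrite expfzDr.
have prod_exp (f : 'I_r -> C) m : exprz (\prod_i f i) m = \prod_i exprz (f i) m.
  by elim/big_rec2: _ => [|i y z _ <-]; rewrite ?exp1rz // expfzMl.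
under [RHS]eq_bigr do rewrite sum_exp //.
rewrite [RHS]exchange_big /=; apply: eq_bigr => j _.
by rewrite prod_exp; apply: eq_bigr => i _; rewrite exprz_exp.
Qed.

Lemma expcN (x : 'rV[int]_r) t : expc Phi (- x) t = (expc Phi x t)^-1.
Proof.
rewrite /expc -prodfV; apply: eq_bigr => i _.
by rewrite mulNmx mxE invr_expz.
Qed.

Lemma expc_neq0 (x : 'rV[int]_r) t : torus t -> expc Phi x t != 0.
Proof. by move=> tT; apply/prodf_neq0 => i _; apply: expfz_neq0. Qed.

Lemma expc_tinv (x : 'rV[int]_r) t : expc Phi x (tinv t) = (expc Phi x t)^-1.
Proof.
by rewrite /expc -prodfV; apply: eq_bigr => i _; rewrite mxE exprz_inv invr_expz.
Qed.

Lemma expc_cvg (x : 'rV[int]_r) t : torus t ->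
  expc Phi x u @[u --> t] --> expc Phi x t.
Proof. by move=> tT; exact: (@monomial_cvg _ _ _ (nbhs t) _ id t _ tT cvg_id). Qed.

(** In terms of exponents this is the invariance of the pairing of roots with
    coroots. *)
Lemma expc_tact w a t : w \in weyl Phi -> torus t ->
  expc Phi (rs_vec (w a)) (tact w t) = expc Phi (rs_vec a) t.
Proof.
move=> wW tT; rewrite /expc.
under eq_bigr do rewrite tactE.
rewrite monomial_comp //; apply: eq_bigr => i _; congr exprz.
have := pairing_weyl a (rs_simple Phi i) wW; rewrite /pairing.
have rowE (x y : 'rV[int]_r) : (x *m y^T) 0 0 = \sum_j y 0 j * x 0 j.
  by rewrite mxE; apply: eq_bigr => j _; rewrite mxE mulrC.
rewrite !rowE => ->; rewrite rs_covec_simple (bigD1 i) //= mxE !eqxx mul1r.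
by rewrite big1 ?addr0 // => j ji; rewrite mxE (negbTE ji) andbF mul0r.
Qed.

Lemma covec_weyl w a : w \in weyl Phi ->
  rs_covec (w a) = \sum_i rs_covec a 0 i *: rs_covec (w (rs_simple Phi i)).
Proof. exact: (@vec_weyl r (dual Phi)). Qed.

Lemma tact_wmul u w t : u \in weyl Phi -> torus t ->
  tact (wmul u w) t = tact u (tact w t).
Proof.
move=> uW tT; apply/rowP => j; rewrite !tactE.
under [RHS]eq_bigr do rewrite tactE.
rewrite monomial_comp //; apply: eq_bigr => i _; congr exprz.
rewrite permM covec_weyl // summxE; apply: eq_bigr => k _; by rewrite mxE.
Qed.

Lemma tact1 t : tact (1%g : {perm rs_root Phi}) t = t.
Proof.
apply/rowP => j; rewrite tactE (bigD1 j) //= perm1 rs_covec_simple mxE !eqxx.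
rewrite expr1z big1 ?mulr1 // => i ij.
by rewrite perm1 rs_covec_simple mxE eq_sym (negbTE ij) andbF expr0z.
Qed.

Lemma tact_invK w t : w \in weyl Phi -> torus t -> tact w^-1%g (tact w t) = t.
Proof.
by move=> wW tT; rewrite -tact_wmul ?groupV // /wmul mulgV tact1.
Qed.

Lemma tact_invKV w t : w \in weyl Phi -> torus t -> tact w (tact w^-1%g t) = t.
Proof. by move=> wW tT; rewrite -tact_wmul // /wmul mulVg tact1. Qed.

Lemma tact_tinv w t : tact w (tinv t) = tinv (tact w t).
Proof.
apply/rowP => j; rewrite [RHS]mxE !tactE -prodfV; apply: eq_bigr => i _.
by rewrite mxE exprz_inv invr_expz.
Qed.

End TorusAction.

Section Changes.
Variables (R : realType) (r : nat) (Phi : rootSystem r).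
Local Notation C := (Cx R).
Local Notation point := ('rV[C]_r * 'rV[C]_r * C)%type.
Implicit Types (p : point) (w : {perm rs_root Phi}) (a : rs_root Phi).

Lemma dualdual_expc (x : 'rV[int]_r) (t : 'rV[C]_r) :
  expc (dual (dual Phi)) x t = expc Phi x t.
Proof. by rewrite /expc /= trmxK. Qed.

Lemma nuE a p : nu a p = expc (dual Phi) (rs_covec a) p.1.2.
Proof. by []. Qed.

Lemma zetaE a p : zeta a p = (expc Phi (rs_vec a) p.1.1)^-1.
Proof. by rewrite /zeta expcN. Qed.

Lemma nu_neq0 a p : domain p -> nu a p != 0.
Proof. by case=> _ pT _; exact: expc_neq0. Qed.

Lemma zeta_neq0 a p : domain p -> zeta a p != 0.
Proof. by case=> pT _ _; exact: expc_neq0. Qed.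

Lemma nu_opp a p : nu (opp a) p = (nu a p)^-1.
Proof.
by rewrite !nuE (_ : rs_covec (opp a) = - rs_covec a) ?expcN //;
  exact: (@vec_opp r (dual Phi) a).
Qed.

Lemma zeta_opp a p : zeta (opp a) p = (zeta a p)^-1.
Proof. by rewrite !zetaE vec_opp expcN. Qed.

(** Precomposition with these maps gives the operators w^nu and w^zeta on
    functions; the inverse of w makes them send h^lambda to h^(w lambda) and
    e^lambda to e^(w lambda). *)
Definition dynpt w p : point := (p.1.1, @tact R r (dual Phi) w^-1%g p.1.2, p.2).

Definition eqvpt w p : point := (tact w^-1%g p.1.1, p.1.2, p.2).

Lemma dynpt_domain w p : domain p -> domain (dynpt w p).
Proof. by case=> *; split=> //; apply: torus_tact. Qed.

Lemma eqvpt_domain w p : domain p -> domain (eqvpt w p).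
Proof. by case=> *; split=> //; apply: torus_tact. Qed.

Lemma nu_dynpt w a p : w \in weyl Phi -> domain p ->
  nu a (dynpt w p) = nu (w a) p.
Proof.
move=> wW [_ pT _]; rewrite !nuE -[in LHS](permK w a).
by apply: (@expc_tact _ _ (dual Phi)) => //; exact: groupVr.
Qed.

Lemma zeta_eqvpt w a p : w \in weyl Phi -> domain p ->
  zeta a (eqvpt w p) = zeta (w a) p.
Proof.
move=> wW [pT _ _]; rewrite !zetaE -[in LHS](permK w a); congr _^-1.
by apply: expc_tact => //; exact: groupVr.
Qed.

Lemma dynptK w p : w \in weyl Phi -> domain p -> dynpt w^-1%g (dynpt w p) = p.
Proof.
case: p => [[t u] h] wW [/= _ uT _]; rewrite /dynpt /= invgK.
by congr (_, _, _); apply: (@tact_invKV _ _ (dual Phi)).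
Qed.

Lemma eqvptK w p : w \in weyl Phi -> domain p -> eqvpt w^-1%g (eqvpt w p) = p.
Proof.
case: p => [[t u] h] wW [/= tT _ _]; rewrite /eqvpt /= invgK.
by congr (_, _, _); apply: tact_invKV.
Qed.

Lemma dynpt_cont w p : domain p -> {for p, continuous (dynpt w)}.
Proof.
move=> [_ pT _]; apply: (@cvg_point _ _ _ (nbhs p));
  [exact: cvg_point11| |exact: cvg_point2].
exact: (cvg_comp _ _ (@cvg_point12 _ _ p) (@tact_cvg _ _ (dual Phi) _ _ pT)).
Qed.

Lemma eqvpt_cont w p : domain p -> {for p, continuous (eqvpt w)}.
Proof.
move=> [pT _ _]; apply: (@cvg_point _ _ _ (nbhs p));
  [|exact: cvg_point12|exact: cvg_point2].
exact: (cvg_comp _ _ (@cvg_point11 _ _ p) (@tact_cvg _ _ Phi _ _ pT)).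
Qed.

Lemma generic_dynpt w (A : set point) : w \in weyl Phi -> generic A ->
  \forall p \near @generic R r, A (dynpt w p).
Proof.
move=> wW gA.
apply: (@generic_preimage R r (dynpt w) (dynpt w^-1%g) A _ _ _ _ _ _ gA).
- exact: dynpt_domain.
- exact: dynpt_domain.
- exact: dynpt_cont.
- exact: dynpt_cont.
- by move=> p; exact: dynptK.
- by move=> p dp; have := @dynptK w^-1%g p; rewrite invgK groupV; apply.
Qed.

Lemma generic_eqvpt w (A : set point) : w \in weyl Phi -> generic A ->
  \forall p \near @generic R r, A (eqvpt w p).
Proof.
move=> wW gA.
apply: (@generic_preimage R r (eqvpt w) (eqvpt w^-1%g) A _ _ _ _ _ _ gA).
- exact: eqvpt_domain.
- exact: eqvpt_domain.
- exact: eqvpt_cont.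
- exact: eqvpt_cont.
- by move=> p; exact: eqvptK.
- by move=> p dp; have := @eqvptK w^-1%g p; rewrite invgK groupV; apply.
Qed.

(** The change of variables # of the duality, as a map on points. *)
Definition sharppt w p : point := (tinv (tact w p.1.2), p.1.1, p.2^-1).

Lemma sharppt_domain w p : domain p -> domain (sharppt w p).
Proof.
case=> *; split=> //=; last by rewrite invr_eq0.
by apply: torus_tinv; apply: torus_tact.
Qed.

Lemma sharppt_cont w p : domain p -> {for p, continuous (sharppt w)}.
Proof.
move=> [_ pT p0]; apply: (@cvg_point _ _ _ (nbhs p)); [|exact: cvg_point11|]; last first.
  by apply: (@cvgV _ _ (nbhs p)) => //; exact: cvg_point2.
have c := cvg_comp _ _ (@cvg_point12 _ _ p) (@tact_cvg _ _ Phi w _ pT).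
exact: (cvg_comp _ _ c (tinv_cvg (torus_tact w pT))).
Qed.

(** The inverse of [sharppt w]. *)
Definition unsharppt w p : point := (p.1.2, tact w^-1%g (tinv p.1.1), p.2^-1).

Lemma generic_sharppt w (A : set point) : w \in weyl Phi -> generic A ->
  \forall p \near @generic R r, A (sharppt w p).
Proof.
move=> wW gA.
apply: (@generic_preimage R r (sharppt w) (unsharppt w) A _ _ _ _ _ _ gA).
- exact: sharppt_domain.
- case=> [[t u] h] [*]; split=> //=; last by rewrite invr_eq0.
  by apply: torus_tact; apply: torus_tinv.
- exact: sharppt_cont.
- move=> p [pT _ p0]; apply: (@cvg_point _ _ _ (nbhs p)); [exact: cvg_point12| |]; last first.
    by apply: (@cvgV _ _ (nbhs p)) => //; exact: cvg_point2.
  have c := cvg_comp _ _ (@cvg_point11 _ _ p) (tinv_cvg pT).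
  exact: (cvg_comp _ _ c (@tact_cvg _ _ Phi w^-1%g _ (torus_tinv pT))).
- case=> [[t u] h] [/= tT uT h0]; rewrite /unsharppt /sharppt /= tinvK invrK.
  by rewrite tact_invK.
- case=> [[t u] h] [/= tT uT h0]; rewrite /unsharppt /sharppt /= invrK.
  by rewrite tact_invKV ?tinvK //; apply: torus_tinv.
Qed.

End Changes.

(** * Generic nonvanishing of delta *)

Section Nonvanishing.
Variables (R : realType) (q : Cx R) (r : nat) (Phi : rootSystem r).
Hypotheses (q0 : q != 0) (q1 : `|q| < 1).
Local Notation C := (Cx R).
Local Notation point := ('rV[C]_r * 'rV[C]_r * C)%type.
Implicit Types (p : point) (a : rs_root Phi).

(** Through every point passes a path along which g is multiplied by a nonzero
    power of the parameter. Moving slightly along it makes g leave the powers of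
    q, since these are isolated, and then g avoids them on a neighbourhood. *)
Lemma generic_not_qpower (g : point -> C) (path : C -> point -> point)
    (m : int) :
    m != 0 ->
    (forall p, domain p -> [/\ g p != 0, g x @[x --> p] --> g p,
      path s p @[s --> (1 : C)] --> p &
      forall s, s != 0 -> g (path s p) = exprz s m * g p]) ->
  \forall p \near @generic R r, ~ qpower q (g p).
Proof.
move=> m0 hg p dp U pU; have [gp0 gc pc gpath] := hg _ dp.
have hV := gc _ (near_not_qpower q0 q1 gp0).
have near1 : \forall s \near (1 : C), (U `&` [set x | g x != g p -> ~ qpower q (g x)]
    `&` (@domain R r)) (path s p).
  exact: pc (filterI (filterI pU hV) (domain_near dp)).
have [e /= e0 he] := (nbhs_ballP _ _).1 near1.
(* a real number larger than 1, whose nonzero powers differ from 1 *)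
pose s : C := 1 + e / 2.
have s1 : 1 < s by rewrite ltrDl divr_gt0.
have s0 : s != 0 by rewrite gt_eqF // (lt_trans ltr01).
have sb : ball (1 : C) e s.
  rewrite -ball_normE /= /s opprD addrA subrr sub0r normrN gtr0_norm ?divr_gt0 //.
  by rewrite gtr_pMr // invf_lt1 // ltr1n.
have [[Uy Vy] dy] := he _ sb; set y := path s p in Uy Vy dy.
have gy : ~ qpower q (g y).
  apply: Vy; rewrite /y gpath // -[X in _ != X]mul1r (inj_eq (mulIf gp0)).
  by rewrite pexprz_eq1 ?negb_or ?m0 ?gt_eqF // (le_trans ler01) // ltW.
exists y; split=> //; have [gy0 gyc _ _] := hg _ dy.
have near2 : \forall x \near y, g x != g y -> ~ qpower q (g x).
  exact: gyc (near_not_qpower q0 q1 gy0).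
suff : \forall x \near y, ~ qpower q (g x) by [].
apply: filterS near2 => x hx.
by have [->|] := eqVneq (g x) (g y); [exact: gy|exact: hx].
Qed.

Lemma nu_cvg a p : domain p -> nu a x @[x --> p] --> nu a p.
Proof.
move=> [_ pT _].
exact: (cvg_comp _ _ (@cvg_point12 _ _ p) (@expc_cvg _ _ (dual Phi) _ _ pT)).
Qed.

Lemma scale_h_cvg p : (p.1.1, p.1.2, s * p.2) @[s --> (1 : C)] --> p.
Proof.
apply: (@cvg_point _ _ _ (nbhs (1 : C))); [exact: cvg_cst|exact: cvg_cst|].
rewrite -[X in _ --> X]mul1r; apply: (@cvgM _ _ (nbhs (1 : C))).
  exact: cvg_id.
exact: cvg_cst.
Qed.

Definition scale_u (i : 'I_r) (s : C) p : point :=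
  (p.1.1, \row_j (if j == i then s * p.1.2 0 j else p.1.2 0 j), p.2).

Lemma scale_u_cvg i p : scale_u i s p @[s --> (1 : C)] --> p.
Proof.
apply: (@cvg_point _ _ _ (nbhs (1 : C))); [exact: cvg_cst| |exact: cvg_cst].
apply: (@cvg_row _ _ _ (nbhs (1 : C))) => j.
rewrite (_ : (fun s => _) = fun s => if j == i then s * p.1.2 0 j else p.1.2 0 j).
  case: (j == i); last exact: cvg_cst.
  rewrite -[X in _ --> X]mul1r; apply: (@cvgM _ _ (nbhs (1 : C))).
    exact: cvg_id.
  exact: cvg_cst.
by apply/funext => s; rewrite mxE.
Qed.

Lemma expc_scale_u (x : 'rV[int]_r) i s p : s != 0 -> domain p ->
  expc (dual Phi) x (scale_u i s p).1.2 =
  exprz s ((x *m (rs_cartan Phi)^T) 0 i) * expc (dual Phi) x p.1.2.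
Proof.
move=> s0 [_ pT _]; rewrite /expc.
rewrite [LHS](@bigD1 _ _ _ _ i xpredT _ isT).
rewrite [in RHS](@bigD1 _ _ _ _ i xpredT _ isT) mulrA.
rewrite [(scale_u _ _ _).1.2 0 i]mxE eqxx expfzMl; congr (_ * _).
by apply: eq_bigr => j ji; rewrite mxE (negbTE ji).
Qed.

(** By [delta_neq0], delta(nu_a, h) vanishes or has a pole only where nu_a, h or
    their product is a power of q. *)
Lemma generic_delta_neq0 a :
  \forall p \near @generic R r, delta q (nu a p) p.2 != 0.
Proof.
have [i ai] : exists i, (rs_covec a *m (rs_cartan Phi)^T) 0 i != 0.
  have [/existsP//|] := boolP [exists i, (rs_covec a *m (rs_cartan Phi)^T) 0 i != 0].
  rewrite negb_exists => /forallP h; exfalso; have := dual_pair2 a.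
  rewrite (_ : rs_covec a *m (rs_cartan Phi)^T = 0) ?mul0mx ?mxE //.
  by apply/rowP => i; rewrite [RHS]mxE; apply/eqP; have := h i; rewrite negbK.
have gnu : \forall p \near @generic R r, ~ qpower q (nu a p).
  apply: (@generic_not_qpower _ (scale_u i) _ ai) => p dp; split.
  - exact: nu_neq0.
  - exact: nu_cvg.
  - exact: scale_u_cvg.
  - by move=> s s0; exact: expc_scale_u.
have gh : \forall p \near @generic R r, ~ qpower q p.2.
  apply: (@generic_not_qpower _ (fun s p => (p.1.1, p.1.2, s * p.2)) 1) => // p dp.
  split; [by case: dp|exact: cvg_point2|exact: scale_h_cvg|].
  by move=> s _; rewrite expr1z.
have gnuh : \forall p \near @generic R r, ~ qpower q (nu a p * p.2).
  apply: (@generic_not_qpower _ (fun s p => (p.1.1, p.1.2, s * p.2)) 1) => // p dp.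
  split.
  - by apply: mulf_neq0; [exact: nu_neq0|case: dp].
  - by apply: (@cvgM _ _ (nbhs p)); [exact: nu_cvg|exact: cvg_point2].
  - exact: scale_h_cvg.
  - by move=> s _; rewrite expr1z mulrCA.
near=> p; have dp : domain p by near: p; exact: generic_domain.
apply: delta_neq0 => //.
- exact: nu_neq0.
- by case: dp.
- by near: p.
- by near: p.
- by near: p.
Unshelve. all: by end_near. Qed.

End Nonvanishing.

(** * The Bott-Samelson and the R-matrix recursion *)

Section Recursions.
Variables (R : realType) (q : Cx R) (r : nat) (Phi : rootSystem r).
Local Notation C := (Cx R).
Local Notation point := ('rV[C]_r * 'rV[C]_r * C)%type.
Local Notation alpha := (rs_simple Phi).
Local Notation s_ := (wsimple Phi).
Local Notation W := {perm rs_root Phi}.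
Implicit Types (p : point) (a : rs_root Phi) (i j : 'I_r) (w v : W).
Variable E : W -> W -> point -> C.
Hypothesis hE : is_local_elliptic_class q (Phi := Phi) E.

Lemma elliptic_id v : v \in weyl Phi ->
  \forall p \near @generic R r, E 1%g v p = (v == 1%g)%:R.
Proof.
case: hE => _ h1 h0 _ vW; have [->|v1] := eqVneq v 1%g; first exact: h1.
exact: h0.
Qed.

(** The factor on the right-hand side of a recursion, according to whether the
    multiplication increases (b true) or decreases the length. *)
Definition descent (b : bool) a p : C :=
  if b then 1 else delta q (nu a p) p.2 * delta q (nu a p)^-1 p.2.

Lemma bott_samelson w v i : w \in weyl Phi -> v \in weyl Phi ->
  \forall p \near @generic R r,
    delta q (zeta (v (alpha i)) p) (nu (alpha i) p) * E w v (dynpt (s_ i) p) +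
    delta q (zeta (v (alpha i)) p) p.2 * E w (wmul v (s_ i)) (dynpt (s_ i) p) =
    descent (positive (w (alpha i))) (alpha i) p * E (wmul w (s_ i)) v p.
Proof.
case: hE => _ _ _ rec wW vW; have [up down] := rec i w v wW vW.
have [wp|wn] := boolP (positive (w (alpha i))).
  apply: (@filterS _ (@generic R r) _ _ _ _ (up (wlen_up wW wp))) => p /= ->.
  by rewrite mul1r.
exact: down (wlen_down wW wn).
Qed.

Lemma bott_samelson_up w v i : w \in weyl Phi -> v \in weyl Phi ->
  positive (w (alpha i)) ->
  \forall p \near @generic R r, E (wmul w (s_ i)) v p =
    delta q (zeta (v (alpha i)) p) (nu (alpha i) p) * E w v (dynpt (s_ i) p) +
    delta q (zeta (v (alpha i)) p) p.2 * E w (wmul v (s_ i)) (dynpt (s_ i) p).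
Proof.
move=> wW vW wp.
apply: (@filterS _ (@generic R r) _ _ _ _ (bott_samelson i wW vW)) => p /= ->.
by rewrite wp mul1r.
Qed.

(** When w(alpha_j) is positive, forming s_i w s_j by either order of the two
    multiplications yields the same product of descent factors. If w conjugates
    s_j to s_i, then s_i w s_j = w and each order goes up once and down once;
    otherwise s_j and s_i preserve the signs at stake. *)
Lemma descent_comm w i j p : w \in weyl Phi -> domain p ->
  positive (w (alpha j)) ->
  descent (positive (w^-1%g (alpha i))) (w^-1%g (alpha i)) (dynpt (s_ j) p) *
    descent (positive (wmul (s_ i) w (alpha j))) (alpha j) p =
  descent (positive ((wmul w (s_ j))^-1%g (alpha i)))
    ((wmul w (s_ j))^-1%g (alpha i)) p.
Proof.
move=> wW dp wp.
have -> : (wmul w (s_ j))^-1%g (alpha i) = s_ j (w^-1%g (alpha i)).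
  by rewrite /wmul invMg permM wsimpleV.
rewrite permM.
have [e|ne] := eqVneq (w^-1%g (alpha i)) (alpha j).
  have -> : w (alpha j) = alpha i by rewrite -e permKV.
  rewrite e !wsimple_alpha !positive_opp !positive_simple /descent mul1r.
  by rewrite nu_opp invrK mulrC.
have nwo : w^-1%g (alpha i) != opp (alpha j).
  rewrite weyl_inv_opp //; apply: contraTneq wp => e.
  by rewrite -[positive _]negbK -positive_opp -e positive_simple.
rewrite (sign_wsimple ne nwo) (positive_wsimple wp); last first.
  by rewrite eq_sym -weyl_inv_eq.
by rewrite /descent mulr1 nu_dynpt // wsimple_weyl.
Qed.

(** The operators with coefficients (x, y) and (a, b) commute: they are applied
    to the four values [e1], ..., [e4] in either order. *)
Lemma commuting_recursions (x y a b e1 e2 e3 e4 f1 f2 c d g k1 k2 : C) :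
  k1 = a * e1 + b * e2 -> k2 = a * e3 + b * e4 ->
  x * e1 + y * e3 = c * f1 -> x * e2 + y * e4 = c * f2 ->
  a * f1 + b * f2 = d * g -> x * k1 + y * k2 = c * d * g.
Proof.
move=> -> -> h1 h2 h3; rewrite -mulrA -h3 [RHS]mulrDr.
have -> : c * (a * f1) = a * (x * e1 + y * e3) by rewrite h1 mulrCA.
have -> : c * (b * f2) = b * (x * e2 + y * e4) by rewrite h2 mulrCA.
ring.
Qed.

(** The R-matrix recursion. It multiplies w and v on the left, and acts on the
    equivariant variables; the Bott-Samelson recursion multiplies them on the
    right, and acts on the dynamical variables. As operators on families of
    functions indexed by v they commute, so that the R-matrix recursion
    propagates from w to w s_j when this increases the length, starting from
    w = 1, where only v = 1 and v = s_i contribute. *)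
Lemma rmatrix w : w \in weyl Phi -> forall i v, v \in weyl Phi ->
  \forall p \near @generic R r,
    delta q (zeta (alpha i) p) (nu (w^-1%g (alpha i)) p) * E w v p +
    delta q (zeta (alpha i) p)^-1 p.2 * E w (wmul (s_ i) v) (eqvpt (s_ i) p) =
    descent (positive (w^-1%g (alpha i))) (w^-1%g (alpha i)) p *
      E (wmul (s_ i) w) v p.
Proof.
move: w; apply: weyl_ind => [|w j wW wp IH] i v vW.
  rewrite invg1 perm1 positive_simple.
  have sW := wsimple_weyl Phi i.
  have svW := wmul_weyl sW vW; have vsW := wmul_weyl vW sW.
  have e1 : wmul (s_ i) 1%g = wmul 1%g (s_ i) by rewrite /wmul mulg1 mul1g.
  have h0 : positive ((1%g : W) (alpha i)) by rewrite perm1 positive_simple.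
  near=> p; rewrite mul1r e1.
  have -> : E 1%g v p = (v == 1%g)%:R by near: p; exact: elliptic_id.
  have -> : E 1%g (wmul (s_ i) v) (eqvpt (s_ i) p) = (wmul (s_ i) v == 1%g)%:R.
    by near: p; exact: generic_eqvpt sW (elliptic_id svW).
  have -> : E (wmul 1%g (s_ i)) v p =
      delta q (zeta (v (alpha i)) p) (nu (alpha i) p) * E 1%g v (dynpt (s_ i) p) +
      delta q (zeta (v (alpha i)) p) p.2 * E 1%g (wmul v (s_ i)) (dynpt (s_ i) p).
    by near: p; apply: bott_samelson_up => //; exact: group1.
  have -> : E 1%g v (dynpt (s_ i) p) = (v == 1%g)%:R.
    by near: p; exact: generic_dynpt sW (elliptic_id vW).
  have -> : E 1%g (wmul v (s_ i)) (dynpt (s_ i) p) = (wmul v (s_ i) == 1%g)%:R.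
    by near: p; exact: generic_dynpt sW (elliptic_id vsW).
  have -> : (wmul (s_ i) v == 1%g) = (v == s_ i).
    by rewrite [RHS]eq_mulgV1 wsimpleV.
  have -> : (wmul v (s_ i) == 1%g) = (v == s_ i).
    by rewrite [RHS]eq_sym [RHS]eq_mulVg1 wsimpleV.
  have [->|v1] := eqVneq v 1%g.
    by rewrite eq_sym (negbTE (wsimple_neq1 Phi i)) !mulr0 perm1.
  rewrite !mulr0; have [->|_] := eqVneq v (s_ i); last by rewrite !mulr0.
  by rewrite wsimple_alpha zeta_opp.
have sW := wsimple_weyl Phi i; have tW := wsimple_weyl Phi j.
have wtW := wmul_weyl wW tW; have siwW := wmul_weyl sW wW.
have svW := wmul_weyl sW vW; have vtW := wmul_weyl vW tW.
near=> p.
have dp : domain p by near: p; exact: generic_domain.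
have F1 : E (wmul w (s_ j)) v p =
      delta q (zeta (v (alpha j)) p) (nu (alpha j) p) * E w v (dynpt (s_ j) p) +
      delta q (zeta (v (alpha j)) p) p.2 * E w (wmul v (s_ j)) (dynpt (s_ j) p).
  by near: p; exact: bott_samelson_up.
have F2 : E (wmul w (s_ j)) (wmul (s_ i) v) (eqvpt (s_ i) p) =
      delta q (zeta (v (alpha j)) p) (nu (alpha j) p) *
        E w (wmul (s_ i) v) (eqvpt (s_ i) (dynpt (s_ j) p)) +
      delta q (zeta (v (alpha j)) p) p.2 *
        E w (wmul (s_ i) (wmul v (s_ j))) (eqvpt (s_ i) (dynpt (s_ j) p)).
  have -> : zeta (v (alpha j)) p = zeta (wmul (s_ i) v (alpha j)) (eqvpt (s_ i) p).
    by rewrite zeta_eqvpt // permM wsimpleK.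
  have -> : wmul (s_ i) (wmul v (s_ j)) = wmul (wmul (s_ i) v) (s_ j).
    by rewrite /wmul mulgA.
  by near: p; exact: generic_eqvpt sW (bott_samelson_up wW svW wp).
have F3 : delta q (zeta (alpha i) p) (nu ((wmul w (s_ j))^-1%g (alpha i)) p) *
      E w v (dynpt (s_ j) p) + delta q (zeta (alpha i) p)^-1 p.2 *
      E w (wmul (s_ i) v) (eqvpt (s_ i) (dynpt (s_ j) p)) =
    descent (positive (w^-1%g (alpha i))) (w^-1%g (alpha i)) (dynpt (s_ j) p) *
      E (wmul (s_ i) w) v (dynpt (s_ j) p).
  have -> : nu ((wmul w (s_ j))^-1%g (alpha i)) p =
      nu (w^-1%g (alpha i)) (dynpt (s_ j) p).
    by rewrite nu_dynpt // /wmul invMg permM wsimpleV.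
  by near: p; exact: generic_dynpt tW (IH i v vW).
have F4 : delta q (zeta (alpha i) p) (nu ((wmul w (s_ j))^-1%g (alpha i)) p) *
      E w (wmul v (s_ j)) (dynpt (s_ j) p) + delta q (zeta (alpha i) p)^-1 p.2 *
      E w (wmul (s_ i) (wmul v (s_ j))) (eqvpt (s_ i) (dynpt (s_ j) p)) =
    descent (positive (w^-1%g (alpha i))) (w^-1%g (alpha i)) (dynpt (s_ j) p) *
      E (wmul (s_ i) w) (wmul v (s_ j)) (dynpt (s_ j) p).
  have -> : nu ((wmul w (s_ j))^-1%g (alpha i)) p =
      nu (w^-1%g (alpha i)) (dynpt (s_ j) p).
    by rewrite nu_dynpt // /wmul invMg permM wsimpleV.
  by near: p; exact: generic_dynpt tW (IH i (wmul v (s_ j)) vtW).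
have F5 : delta q (zeta (v (alpha j)) p) (nu (alpha j) p) *
      E (wmul (s_ i) w) v (dynpt (s_ j) p) +
    delta q (zeta (v (alpha j)) p) p.2 *
      E (wmul (s_ i) w) (wmul v (s_ j)) (dynpt (s_ j) p) =
    descent (positive (wmul (s_ i) w (alpha j))) (alpha j) p *
      E (wmul (s_ i) (wmul w (s_ j))) v p.
  rewrite (_ : wmul (s_ i) (wmul w _) = wmul (wmul (s_ i) w) (s_ j)).
    by near: p; exact: bott_samelson.
  by rewrite /wmul mulgA.
rewrite -(descent_comm i wW dp wp).
exact: commuting_recursions F1 F2 F3 F4 F5.
Unshelve. all: by end_near. Qed.

End Recursions.

(** * Support and diagonal values, and the recursion of the dual group *)

Section Support.
Variables (R : realType) (q : Cx R) (r : nat) (Phi : rootSystem r).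
Local Notation C := (Cx R).
Local Notation point := ('rV[C]_r * 'rV[C]_r * C)%type.
Local Notation alpha := (rs_simple Phi).
Local Notation s_ := (wsimple Phi).
Local Notation W := {perm rs_root Phi}.
Implicit Types (p : point) (a : rs_root Phi) (i j : 'I_r) (w v : W).
Variable E : W -> W -> point -> C.
Hypothesis hE : is_local_elliptic_class q (Phi := Phi) E.

(** The fixed points of X_w other than w are shorter than w: at each step of the
    recursion v is replaced by itself or by v s_j, which is shorter than v by at
    most one. *)
Lemma elliptic_support w : w \in weyl Phi -> forall v, v \in weyl Phi ->
  (ninv w <= ninv v)%N -> v != w -> \forall p \near @generic R r, E w v p = 0.
Proof.
move: w; apply: weyl_ind => [|w j wW wp IH] v vW wv ne.
  apply: (@filterS _ (@generic R r) _ _ _ _ (elliptic_id hE vW)) => p /= ->.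
  by rewrite (negbTE ne).
have tW := wsimple_weyl Phi j; have vtW := wmul_weyl vW tW.
rewrite ninv_wmul // in wv.
have Z1 : \forall p \near @generic R r, E w v p = 0.
  apply: IH => //; first exact: ltnW.
  by apply: contraTneq wv => ->; rewrite ltnn.
have Z2 : \forall p \near @generic R r, E w (wmul v (s_ j)) p = 0.
  apply: IH => //; last first.
    by apply: contra ne => /eqP <-; rewrite wmul_wsimpleK.
  have [vp|vn] := boolP (positive (v (alpha j))).
    by rewrite ninv_wmul // (leq_trans (ltnW wv)).
  by rewrite -ltnS -ninv_wmul_neg.
near=> p.
have -> : E (wmul w (s_ j)) v p =
      delta q (zeta (v (alpha j)) p) (nu (alpha j) p) * E w v (dynpt (s_ j) p) +
      delta q (zeta (v (alpha j)) p) p.2 * E w (wmul v (s_ j)) (dynpt (s_ j) p).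
  by near: p; exact: bott_samelson_up.
have -> : E w v (dynpt (s_ j) p) = 0 by near: p; exact: generic_dynpt tW Z1.
have -> : E w (wmul v (s_ j)) (dynpt (s_ j) p) = 0.
  by near: p; exact: generic_dynpt tW Z2.
by rewrite !mulr0 addr0.
Unshelve. all: by end_near. Qed.

(** By [elliptic_support] only the second term of the recursion contributes. *)
Lemma elliptic_diagonal w : w \in weyl Phi ->
  \forall p \near @generic R r, E w w p =
    \prod_(a | positive a && ~~ positive (w^-1%g a)) delta q (zeta a p)^-1 p.2.
Proof.
move: w; apply: weyl_ind => [|w j wW wp IH].
  apply: (@filterS _ (@generic R r) _ _ _ _ (elliptic_id hE (group1 _))) => p /= ->.
  rewrite eqxx big_pred0 // => a.
  by rewrite invg1 perm1 andbN.
have tW := wsimple_weyl Phi j; have wtW := wmul_weyl wW tW.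
have Z : \forall p \near @generic R r, E w (wmul w (s_ j)) p = 0.
  apply: elliptic_support => //; first by rewrite ninv_wmul.
  by apply/eqP => /(congr1 (@ninv _ _)); rewrite ninv_wmul //; lia.
near=> p.
have -> : E (wmul w (s_ j)) (wmul w (s_ j)) p =
      delta q (zeta (wmul w (s_ j) (alpha j)) p) (nu (alpha j) p) *
        E w (wmul w (s_ j)) (dynpt (s_ j) p) +
      delta q (zeta (wmul w (s_ j) (alpha j)) p) p.2 *
        E w (wmul (wmul w (s_ j)) (s_ j)) (dynpt (s_ j) p).
  by near: p; exact: bott_samelson_up.
have -> : E w (wmul w (s_ j)) (dynpt (s_ j) p) = 0.
  by near: p; exact: generic_dynpt tW Z.
rewrite wmul_wsimpleK mulr0 add0r.
have -> : E w w (dynpt (s_ j) p) =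
    \prod_(a | positive a && ~~ positive (w^-1%g a))
      delta q (zeta a (dynpt (s_ j) p))^-1 (dynpt (s_ j) p).2.
  by near: p; exact: generic_dynpt tW IH.
by rewrite prod_coinversions // permM wsimple_alpha weyl_opp // zeta_opp.
Unshelve. all: by end_near. Qed.

(** As s_j permutes the positive roots other than alpha_j, it transports the
    factors of one normalization to those of the other, except for alpha_j,
    which it makes negative. *)
Lemma cnorm_dynpt w j p :
    w \in weyl Phi -> domain p -> positive (w (alpha j)) ->
  cnorm q w (dynpt (s_ j) p) =
  delta q (nu (alpha j) p) p.2 * cnorm q (wmul w (s_ j)) p.
Proof.
move=> wW dp wp; have sW := wsimple_weyl Phi j.
rewrite /cnorm; move: (delta q) => D.
rewrite [LHS](bigD1 (alpha j)) /=; last by rewrite positive_simple wp.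
rewrite (nu_dynpt _ sW dp) wsimple_alpha nu_opp invrK.
congr (_ * _).
rewrite (reindex_inj (@perm_inj _ (s_ j))) /=; apply: eq_big => [b|b _]; last first.
  by rewrite (nu_dynpt _ sW dp) wsimpleK.
rewrite /wmul permM.
have [->|bj] := eqVneq b (alpha j).
  by rewrite wsimple_alpha positive_opp positive_simple weyl_opp // positive_opp wp andbF.
have [->|bo] := eqVneq b (opp (alpha j)).
  by rewrite weyl_opp // wsimple_alpha oppK eqxx andbF positive_opp positive_simple.
rewrite (sign_wsimple bj bo) [s_ j b == _](_ : _ = false) ?andbT //.
apply/negbTE; apply: contra bo => /eqP e.
by rewrite -wsimple_alpha -e wsimpleK.
Qed.

End Support.

Section Duality.
Variables (R : realType) (q : Cx R) (r : nat) (Phi : rootSystem r).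
Hypotheses (q0 : q != 0) (q1 : `|q| < 1).
Local Notation C := (Cx R).
Local Notation point := ('rV[C]_r * 'rV[C]_r * C)%type.
Local Notation alpha := (rs_simple Phi).
Local Notation s_ := (wsimple Phi).
Local Notation W := {perm rs_root Phi}.
Implicit Types (p : point) (a : rs_root Phi) (i j k : 'I_r) (w v : W).
Variable tau0 : W.
Hypothesis longest_tau0 : longest tau0.
Variable E : W -> W -> point -> C.
Hypothesis hE : is_local_elliptic_class q (Phi := Phi) E.

Local Notation zeta' := (@zeta R r (dual Phi)).
Local Notation nu' := (@nu R r (dual Phi)).
Local Notation dynpt' := (@dynpt R r (dual Phi)).

Let tau0W : tau0 \in weyl Phi := longest_tau0.1.

Let tau0V : (tau0^-1)%g = tau0.
Proof. by apply/eqP; rewrite eq_invg_mul; apply/eqP/longest_involutive. Qed.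

Let tau0K a : tau0 (tau0 a) = a.
Proof. by rewrite -permM longest_involutive // perm1. Qed.

Lemma nu_dualE a p : nu' a p = expc Phi (rs_vec a) p.1.2.
Proof. by rewrite nuE dualdual_expc. Qed.

Lemma zeta_sharp a p : domain p -> zeta a (sharppt tau0 p) = nu' (tau0 a) p.
Proof.
move=> [_ pT _]; rewrite zetaE nu_dualE /= expc_tinv invrK.
by rewrite -[in LHS](tau0K a) expc_tact.
Qed.

Lemma nu_sharp a p : nu a (sharppt tau0 p) = (zeta' a p)^-1.
Proof. by rewrite zetaE invrK. Qed.

Lemma wsimple_longest i k : tau0 (alpha k) = opp (alpha i) ->
  wmul (s_ i) tau0 = wmul tau0 (s_ k).
Proof.
move=> ki; rewrite /wsimple -(refl_opp (alpha i)) -ki -(refl_conj _ tau0W).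
by rewrite /wmul conjgE mulKVg.
Qed.

(** s_i and s_k being conjugate under tau0, the equivariant action of s_i
    becomes the dynamical action of s_k. *)
Lemma eqvpt_sharp i k p : domain p -> tau0 (alpha k) = opp (alpha i) ->
  eqvpt (s_ i) (sharppt tau0 p) = sharppt tau0 (dynpt' (s_ k) p).
Proof.
move=> [_ pT _] ki; have e := wsimple_longest ki.
rewrite /eqvpt /sharppt /dynpt /= !wsimpleV; congr (_, _, _).
rewrite tact_tinv; congr tinv.
transitivity (tact (wmul (s_ i) tau0) p.1.2).
  by rewrite tact_wmul // wsimple_weyl.
by rewrite e tact_wmul.
Qed.

(** The normalized classes of G, in the variables and with the indices of the
    dual group: w stands for a Schubert variety, v for a fixed point. *)
Definition sharp_class w v p : C :=
  normalized q E (wmul tau0 v^-1%g) (wmul tau0 w^-1%g) (sharppt tau0 p).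

Lemma cnorm_sharp v p : v \in weyl Phi ->
  cnorm q (wmul tau0 v^-1%g) (sharppt tau0 p) =
  \prod_(a | positive a && ~~ positive (v^-1%g a)) delta q (zeta' a p) p.2^-1.
Proof.
move=> vW; rewrite /cnorm; apply: eq_big => [a|a _].
  by rewrite permM longest_negative.
by rewrite nu_sharp invrK.
Qed.

Lemma solve_middle (a b c e d d' f1 f2 f3 : C) :
  a * f1 + - b * f2 = c * f3 -> c * d = - (e * d') ->
  b * (d * f2) = a * (d * f1) + e * (d' * f3).
Proof.
move=> h1 h2; have -> : b * (d * f2) = a * (d * f1) - d * (a * f1 + - b * f2) by ring.
have -> : d * (a * f1 + - b * f2) = c * d * f3 by rewrite h1; ring.
rewrite h2; ring.
Qed.

(** The R-matrix recursion of G for the Schubert variety tau0 v^-1 and the fixed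
    point tau0 w^-1 relates the classes of indices (w, v), (w s_k, v) and
    (w, v s_k). Solved for the second one it takes the form of the Bott-Samelson
    recursion of the dual group: by [delta_inv], the normalization turns the
    coefficient of the third one, 1 or a product of two deltas, into
    delta(v(zeta_k), h) in both cases. *)
Lemma sharp_recursion k w v : w \in weyl Phi -> v \in weyl Phi ->
  \forall p \near @generic R r,
    delta q (nu' (alpha k) p) p.2 * sharp_class (wmul w (s_ k)) v p =
    delta q (zeta' (v (alpha k)) p) (nu' (alpha k) p) *
      sharp_class w v (dynpt' (s_ k) p) +
    delta q (zeta' (v (alpha k)) p) p.2 *
      sharp_class w (wmul v (s_ k)) (dynpt' (s_ k) p).
Proof.
move=> wW vW; have [i ki] := longest_simple k longest_tau0.
have ik : tau0 (alpha i) = opp (alpha k).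
  by rewrite -[alpha i]oppK -ki weyl_opp // tau0K.
have sW := wsimple_weyl Phi k.
pose om := wmul tau0 v^-1%g; pose sg := wmul tau0 w^-1%g.
have omW : om \in weyl Phi by rewrite wmul_weyl ?groupV.
have sgW : sg \in weyl Phi by rewrite wmul_weyl ?groupV.
have conj := wsimple_longest ki.
have left_mul u : wmul (s_ i) (wmul tau0 u^-1%g) = wmul tau0 (wmul u (s_ k))^-1%g.
  rewrite /wmul -mulgA -[(tau0 * _)%g]/(wmul _ _) conj /wmul invMg wsimpleV.
  by rewrite mulgA.
have omV : om^-1%g (alpha i) = opp (v (alpha k)).
  by rewrite /om /wmul invMg invgK permM tau0V ik weyl_opp.
have rmg := generic_dynpt (Phi := dual Phi) sW
  (generic_sharppt tau0W (rmatrix hE omW i sgW)).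
near=> p.
have dp : domain p by near: p; exact: generic_domain.
have dsp : domain (dynpt' (s_ k) p) by exact: dynpt_domain.
pose P := sharppt tau0 (dynpt' (s_ k) p).
have rm : delta q (zeta (alpha i) P) (nu (om^-1%g (alpha i)) P) * E om sg P +
    delta q (zeta (alpha i) P)^-1 P.2 * E om (wmul (s_ i) sg) (eqvpt (s_ i) P) =
    descent q (positive (om^-1%g (alpha i))) (om^-1%g (alpha i)) P *
      E (wmul (s_ i) om) sg P.
  by rewrite /P; near: p.
have zP : zeta (alpha i) P = nu' (alpha k) p.
  rewrite zeta_sharp // ik (nu_dynpt (Phi := dual Phi)) //.
  by congr nu; rewrite -[LHS]/(s_ k _) weyl_opp // wsimple_alpha oppK.
have nP : nu (opp (v (alpha k))) P = zeta' (v (alpha k)) p.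
  by rewrite nu_opp nu_sharp invrK.
have sP : eqvpt (s_ i) P = sharppt tau0 p.
  rewrite (eqvpt_sharp dsp ki); congr sharppt.
  by have := @dynptK R r (dual Phi) (s_ k) p sW dp; rewrite wsimpleV.
rewrite omV !left_mul zP nP sP positive_opp -/om in rm.
have x0 : zeta' (v (alpha k)) p != 0 := @zeta_neq0 R r (dual Phi) _ _ dp.
have y0 : nu' (alpha k) p != 0 := @nu_neq0 R r (dual Phi) _ _ dp.
have h0 : p.2 != 0 by case: dp.
rewrite (delta_inv q1 y0 h0) in rm.
pose D (u : W) := \prod_(a | positive a && ~~ positive (u^-1%g a)) delta q (zeta' a p) p.2^-1.
have Dp u : u \in weyl Phi -> cnorm q (wmul tau0 u^-1%g) (sharppt tau0 p) = D u.
  by move=> uW; exact: cnorm_sharp.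
have DP u : u \in weyl Phi -> cnorm q (wmul tau0 u^-1%g) P = D u.
  by move=> uW; exact: (@cnorm_sharp u (dynpt' (s_ k) p)).
have vsW := wmul_weyl vW sW.
(* passing from v to v s_k adds or removes one factor of the normalization *)
have key : descent q (~~ positive (v (alpha k))) (opp (v (alpha k))) P * D v =
    - (delta q (zeta' (v (alpha k)) p) p.2 * D (wmul v (s_ k))).
  rewrite /descent nP -[P.2]/(p.2^-1) (delta_inv q1 x0 h0).
  have [vp|vn] /= := boolP (positive (v (alpha k))).
    have -> : D (wmul v (s_ k)) = delta q (zeta' (v (alpha k)) p) p.2^-1 * D v.
      exact: prod_coinversions.
    by rewrite mulrN mulNr; congr (- _); rewrite -mulrA mulrCA.
  have -> : D v = delta q (zeta' (v (alpha k)) p)^-1 p.2^-1 * D (wmul v (s_ k)).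
    have vsp : positive (wmul v (s_ k) (alpha k)) by rewrite positive_wmul.
    have := prod_coinversions (fun a => delta q (zeta' a p) p.2^-1) vsW vsp.
    rewrite wmul_wsimpleK permM wsimple_alpha weyl_opp //.
    by rewrite -[opp _]/(@opp r (dual Phi) _) zeta_opp.
  by rewrite mul1r (delta_inv q1 x0 h0) mulNr.
rewrite /sharp_class /normalized -/P -/om -/sg (DP v vW) (DP _ vsW) (Dp v vW).
rewrite (deltaC q (zeta' (v (alpha k)) p) (nu' (alpha k) p)).
exact: solve_middle rm key.
Unshelve. all: by end_near. Qed.

End Duality.

(** * The duality *)

Section Main.
Variables (R : realType) (q : Cx R) (r : nat) (Phi : rootSystem r).
Hypotheses (q0 : q != 0) (q1 : `|q| < 1).
Local Notation C := (Cx R).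
Local Notation point := ('rV[C]_r * 'rV[C]_r * C)%type.
Local Notation alpha := (rs_simple Phi).
Local Notation s_ := (wsimple Phi).
Local Notation W := {perm rs_root Phi}.
Implicit Types (p : point) (a : rs_root Phi) (k : 'I_r) (w v : W).
Variable tau0 : W.
Hypothesis longest_tau0 : longest tau0.
Variable E : W -> W -> point -> C.
Hypothesis hE : is_local_elliptic_class q (Phi := Phi) E.

Local Notation zeta' := (@zeta R r (dual Phi)).
Local Notation nu' := (@nu R r (dual Phi)).
Local Notation dynpt' := (@dynpt R r (dual Phi)).

Let tau0W : tau0 \in weyl Phi := longest_tau0.1.

(** The initial condition of the dual group. The fixed point tau0 lies on X_w for
    w = tau0 only, and the class of X_tau0 there is a product of deltas over the
    positive roots; inverting the arguments of each of them by [delta_inv]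
    produces the sign and the normalization of the dual group. *)
Lemma sharp_class_id v : v \in weyl Phi ->
  \forall p \near @generic R r,
    (-1) ^+ wlen tau0 * sharp_class q tau0 E 1%g v p =
    cnorm q (Phi := dual Phi) 1%g p * (v == 1%g)%:R.
Proof.
move=> vW; rewrite /sharp_class /normalized invg1.
have e1 : wmul tau0 1%g = tau0 by rewrite /wmul mul1g.
have [->|v1] := eqVneq v 1%g; last first.
  have Z : \forall p \near @generic R r,
      E (wmul tau0 v^-1%g) (wmul tau0 1%g) (sharppt tau0 p) = 0.
    apply: (generic_sharppt tau0W (A := [set p | _ = _])).
    have tvW : wmul tau0 v^-1%g \in weyl Phi by rewrite wmul_weyl ?groupV.
    rewrite e1; apply: (elliptic_support hE) => //.
      by rewrite -!wlen_ninv //; exact: longest_tau0.2.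
    by rewrite /wmul -[X in X != _]mul1g (inj_eq (mulIg _)) eq_sym invg_eq1.
  by apply: (@filterS _ (@generic R r) _ _ _ _ Z) => p /= ->; rewrite !mulr0.
have F := generic_sharppt tau0W (elliptic_diagonal hE tau0W).
near=> p.
have dp : domain p by near: p; exact: generic_domain.
have -> : cnorm q (wmul tau0 1^-1) (sharppt tau0 p) = 1.
  rewrite invg1 e1 /cnorm big_pred0 // => a.
  by rewrite longest_negative // andbN.
rewrite invg1 e1 mul1r mulr1.
have -> : E tau0 tau0 (sharppt tau0 p) =
    \prod_(a | positive a && ~~ positive (tau0^-1%g a))
      delta q (zeta a (sharppt tau0 p))^-1 p.2^-1 by near: p.
have p0 : p.2 != 0 by case: dp.
have n0 a : nu' a p != 0 := @nu_neq0 R r (dual Phi) a p dp.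
have term a : delta q (zeta a (sharppt tau0 p))^-1 p.2^-1 =
    - delta q (nu' (tau0 a) p) p.2.
  by rewrite zeta_sharp // delta_inv.
under eq_bigr do rewrite term.
have tau0V : (tau0^-1)%g = tau0.
  by apply/eqP; rewrite eq_invg_mul; apply/eqP/longest_involutive.
have tau0K a : tau0 (tau0 a) = a by rewrite -permM longest_involutive // perm1.
rewrite (eq_bigl (fun a => a \in [set b : rs_root Phi | positive b]%SET)); last first.
  by move=> a; rewrite tau0V longest_negative // negbK andbb finset.in_set.
rewrite prodrN wlen_longest // mulrA -exprD -signr_odd oddD addbb mul1r.
rewrite /cnorm [RHS](eq_bigl (fun a => positive a)); last first.
  by move=> a; rewrite perm1 andbb positive_dual.
(* minus tau0 permutes the positive roots *)
have opp_inj : injective (fun a => opp (tau0 a)).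
  by move=> a b /(congr1 (@opp _ _)); rewrite !oppK => /perm_inj.
rewrite [LHS](reindex_inj opp_inj); apply: eq_big => [a|a _].
  by rewrite finset.in_set positive_opp longest_negative // negbK.
by rewrite weyl_opp // tau0K -[opp a]/(@opp r (dual Phi) a) nu_opp.
Unshelve. all: by end_near. Qed.

Lemma same_recursion (e a b k1 k2 f1 f2 c d c' : C) :
  e * k1 = c * f1 -> e * k2 = c * f2 -> c = d * c' ->
  e * (a * k1 + b * k2) = d * (c' * (a * f1 + b * f2)).
Proof.
move=> h1 h2 h3; rewrite mulrDr (mulrCA e a) (mulrCA e b) h1 h2 h3; ring.
Qed.

(** Both sides satisfy the same recursion: multiplied by delta(nu_k, h), which
    [cnorm_dynpt] produces on the side of the dual group, the value at w s_k is
    the same combination of values at w. That factor can be cancelled, being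
    generically nonzero. *)
Lemma sharp_class_dual (Ev : W -> W -> point -> C)
    (hEv : is_local_elliptic_class q (Phi := dual Phi) Ev) w :
  w \in weyl Phi -> forall v, v \in weyl Phi ->
  \forall p \near @generic R r,
    (-1) ^+ wlen tau0 * sharp_class q tau0 E w v p =
    cnorm q (Phi := dual Phi) w p * Ev w v p.
Proof.
move: w; apply: weyl_ind => [|w k wW wp IH] v vW.
  have I := @elliptic_id _ _ _ (dual Phi) _ hEv v vW.
  near=> p; have -> : Ev 1%g v p = (v == 1%g)%:R by near: p.
  by near: p; exact: sharp_class_id.
have sW := wsimple_weyl Phi k; have vsW := wmul_weyl vW sW.
have wp' : @positive r (dual Phi) (w (alpha k)) by rewrite positive_dual.
have I1 := generic_dynpt (Phi := dual Phi) sW (IH v vW).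
have I2 := generic_dynpt (Phi := dual Phi) sW (IH _ vsW).
have S := sharp_recursion q1 longest_tau0 hE k wW vW.
have B := @bott_samelson_up _ _ _ (dual Phi) _ hEv w v k wW vW wp'.
have N := @generic_delta_neq0 R q r (dual Phi) q0 q1 (alpha k).
near=> p; have dp : domain p by near: p; exact: generic_domain.
have n0 : delta q (nu' (alpha k) p) p.2 != 0 by near: p.
apply: (mulfI n0); rewrite mulrCA.
have -> : delta q (nu' (alpha k) p) p.2 * sharp_class q tau0 E (wmul w (s_ k)) v p =
    delta q (zeta' (v (alpha k)) p) (nu' (alpha k) p) *
      sharp_class q tau0 E w v (dynpt' (s_ k) p) +
    delta q (zeta' (v (alpha k)) p) p.2 *
      sharp_class q tau0 E w (wmul v (s_ k)) (dynpt' (s_ k) p) by near: p.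
have -> : Ev (wmul w (s_ k)) v p =
    delta q (zeta' (v (alpha k)) p) (nu' (alpha k) p) * Ev w v (dynpt' (s_ k) p) +
    delta q (zeta' (v (alpha k)) p) p.2 * Ev w (wmul v (s_ k)) (dynpt' (s_ k) p).
  by near: p.
have i1 : (-1) ^+ wlen tau0 * sharp_class q tau0 E w v (dynpt' (s_ k) p) =
    cnorm q (Phi := dual Phi) w (dynpt' (s_ k) p) * Ev w v (dynpt' (s_ k) p).
  by near: p.
have i2 : (-1) ^+ wlen tau0 *
      sharp_class q tau0 E w (wmul v (s_ k)) (dynpt' (s_ k) p) =
    cnorm q (Phi := dual Phi) w (dynpt' (s_ k) p) *
      Ev w (wmul v (s_ k)) (dynpt' (s_ k) p) by near: p.
have c : cnorm q (Phi := dual Phi) w (dynpt' (s_ k) p) =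
    delta q (nu' (alpha k) p) p.2 * cnorm q (Phi := dual Phi) (wmul w (s_ k)) p.
  exact: (@cnorm_dynpt R q r (dual Phi) w k p wW dp wp').
exact: same_recursion i1 i2 c.
Unshelve. all: by end_near. Qed.

End Main.

Theorem theorem7 (R : realType) (q : Cx R) (hq0 : q != 0) (hq1 : `|q| < 1)
    (r : nat) (Phi : rootSystem r)
    (tau0 : {perm rs_root Phi}) (htau0 : longest tau0)
    (E : {perm rs_root Phi} -> {perm rs_root Phi} ->
         'rV[Cx R]_r * 'rV[Cx R]_r * Cx R -> Cx R)
    (hE : is_local_elliptic_class q (Phi := Phi) E)
    (Ev : {perm rs_root (dual Phi)} -> {perm rs_root (dual Phi)} ->
          'rV[Cx R]_r * 'rV[Cx R]_r * Cx R -> Cx R)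
    (hEv : is_local_elliptic_class q (Phi := dual Phi) Ev)
    (w v : {perm rs_root Phi}) (hw : w \in weyl Phi) (hv : v \in weyl Phi) :
  eqmero
    (fun p => (-1) ^+ wlen tau0 *
       sharp tau0
         (normalized q (Phi := Phi) E (wmul tau0 (v^-1)%g) (wmul tau0 (w^-1)%g)) p)
    (normalized q (Phi := dual Phi) Ev w v).
Proof. exact: sharp_class_dual. Qed.
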